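(* Let $-\infty<a\le b<\infty$ and let $\omega$ be a weight function satisfying $$(\delta)\quad 2\omega(t)\le\omega(Ht)+\log A,\ t\ge0,\ \text{ for some }A,H\ge1,\qquad (\epsilon)_0\quad \int_0^\infty \omega(t)e^{-\mu t}\,dt<\infty\ \text{ for all }\mu>0.$$ Then the sequence $$0\longrightarrow\mathcal{U}'_{(\omega)}[[a,b]+i\mathbb{R}]\longrightarrow\mathcal{U}'_{(\omega),a+}\oplus\mathcal{U}'_{(\omega),b-}\xrightarrow{\ \lambda\ }\mathcal{U}'_{(\omega)}(\mathbb{C})\longrightarrow0$$ is exact, where $\lambda((f_1,f_2))=f_1-f_2$ and the first non-zero map is $f\mapsto(f,f)$.
   Context: A weight function is a non-decreasing function $\omega:[0,\infty)\to[0,\infty)$, always assumed to satisfy $\lim_{t\to\infty}\omega(t)/\log t=\infty$; it is extended to $\mathbb{R}$ by $\omega(t)=\omega(|t|)$. Write $z=x+iy$, $T^h=\mathbb{R}+i(-h,h)$, and, for $0<b<R$, $T^{b,R}=T^R\setminus\overline{T^b}$. $\mathcal{U}_{(\omega)}(\mathbb{C})$ is the space of entire functions $\varphi$ with $\sup_{z\in T^h}|\varphi(z)|e^{\omega(\lambda x)}<\infty$ for all $h,\lambda>0$, topologized by these norms; $\mathcal{U}'_{(\omega)}(\mathbb{C})$ is its topological dual. If, for some $b,\lambda>0$, $F$ is analytic on $\mathbb{C}\setminus\overline{T^b}$ with $\sup_{z\in T^{b,R}}|F(z)|e^{-\omega(\lambda x)}<\infty$ for every $R>b$, then $\operatorname{bv}(F)\in\mathcal{U}'_{(\omega)}(\mathbb{C})$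 is defined by $\langle\operatorname{bv}(F),\varphi\rangle=-\int_{\Gamma_k}F(z)\varphi(z)\,dz$, where $k>b$ and $\Gamma_k$ is the counterclockwise oriented boundary of $T^k$ (independent of $k$). Real support. Let $\overline{\mathbb{R}}=[-\infty,\infty]$ with its usual compact topology. For $A\subseteq\overline{\mathbb{R}}$ put $T^R(A)=(A\cap\mathbb{R})+i(-R,R)$ and $T^{b,R}(A)=T^{b,R}\cup T^R(A)$. For a proper closed set $K\subset\overline{\mathbb{R}}$ with non-empty interior, $\mathcal{O}_\omega^{b,R,\lambda}(K)$ is the space of analytic functions $F$ on $T^{b,R}(\operatorname{int}K)$ with $\sup_{z\in T^{b,R}(\operatorname{int}K)}|F(z)|e^{-\omega(\lambda x)}<\infty$. For $\Omega\subseteq\overline{\mathbb{R}}$ open, $\mathcal{O}_\omega^{h,R,\lambda}(\Omega)=\varprojlim_{K\Subset\Omega}\varprojlim_{b\to h^+}\varprojlim_{L\to R^-}\mathcal{O}_\omega^{b,L,\lambda}(K)$, i.e. the functions analytic on $T^{h,R}(\Omega)$ that lie in $\mathcal{O}_\omega^{b,L,\lambda}(K)$ for all such $K\Subset\Omega$ and $h<b<L<R$; and $\mathcal{O}_{(\omega)}(\Omega+i\mathbb{R})=\bigcup_{\lambda,h>0}\bigcap_{R>h}\mathcal{O}_\omega^{h,R,\lambda}(\Omega)$. An element $f\in\mathcal{U}'_{(\omega)}(\mathbb{C})$ vanishes on $\Omega$ if there is $F\in\mathcal{O}_{(\omega)}(\Omega+i\mathbb{R})$ with $\operatorname{bv}(F)=f$.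 The real support $\operatorname{supp}_{\overline{\mathbb{R}}}f$ is the complement of the largest open subset of $\overline{\mathbb{R}}$ on which $f$ vanishes. For $K\subseteq\overline{\mathbb{R}}$ closed, $\mathcal{U}'_{(\omega)}[K+i\mathbb{R}]=\{f\in\mathcal{U}'_{(\omega)}(\mathbb{C}):\operatorname{supp}_{\overline{\mathbb{R}}}f\subseteq K\}$, and $\mathcal{U}'_{(\omega),a+}=\mathcal{U}'_{(\omega)}[[a,\infty]+i\mathbb{R}]$, $\mathcal{U}'_{(\omega),b-}=\mathcal{U}'_{(\omega)}[[-\infty,b]+i\mathbb{R}]$. *)

(* Defs.v *)
From HB Require Import structures.
From mathcomp Require Import all_boot all_order all_algebra.
From mathcomp Require Import complex.
From mathcomp Require Import all_classical all_reals all_analysis.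
Set Implicit Arguments.
Unset Strict Implicit.
Unset Printing Implicit Defensive.
Import Order.TTheory GRing.Theory Num.Theory.
Import numFieldNormedType.Exports.
Local Open Scope classical_set_scope.
Local Open Scope ring_scope.
Local Open Scope complex_scope.

(* The complex plane: [R[i]^o] carries the topological and normed structures
   of [R[i]] as a module over itself, so that [derivable F z 1] below is
   complex differentiability.  [complex.Re], [complex.Im] and [Normc.normc]
   are the R-valued real part, imaginary part and modulus. *)
Notation cplx R := (R[i]^o).

Section weights.
Context {R : realType}.
Implicit Type w : R -> R.

(* A function on [0, oo[ is encoded by a total function of which only the
   values on [0, oo[ matter, see [wext]. *)
Definition weight_function w :=
  [/\ forall t, 0 <= t -> 0 <= w t,
      forall s t, 0 <= s -> s <= t -> w s <= w t &
      w t / ln t @[t --> +oo] --> +oo].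

Definition wext w (t : R) : R := w `|t|.

Definition cond_delta w :=
  exists A H : R, [/\ 1 <= A, 1 <= H &
    forall t, 0 <= t -> 2 * w t <= w (H * t) + ln A].

Definition cond_epsilon0 w :=
  forall mu : R, 0 < mu ->
    (\int[lebesgue_measure]_(t in `[0%R, +oo[) (w t * expR (- mu * t))%:E
       < +oo)%E.

End weights.

Section strips.
Context {R : realType}.

Definition strip (h : R) : set (cplx R) := [set z | `|complex.Im z| < h].

Definition strip2 (b r : R) : set (cplx R) := strip r `\` closure (strip b).

Definition strip_over (r : R) (A : set (\bar R)) : set (cplx R) :=
  [set z | A (complex.Re z)%:E /\ `|complex.Im z| < r].

Definition strip2_over (b r : R) (A : set (\bar R)) : set (cplx R) :=
  strip2 b r `|` strip_over r A.

Definition analytic_on (D : set (cplx R)) (F : cplx R -> cplx R) :=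
  forall z, D z -> derivable F z 1.

End strips.

Section test_functions.
Context {R : realType} (w : R -> R).

Definition weighted_values (h l : R) (phi : cplx R -> cplx R) : set R :=
  [set Normc.normc (phi z) * expR (wext w (l * complex.Re z)) | z in strip h].

Definition test_norm (h l : R) (phi : cplx R -> cplx R) : R :=
  sup (weighted_values h l phi).

Definition is_test (phi : cplx R -> cplx R) :=
  analytic_on setT phi /\
  forall h l : R, 0 < h -> 0 < l -> has_ubound (weighted_values h l phi).

Definition test_pred : pred (cplx R -> cplx R) := fun phi => `[< is_test phi >].

Lemma test_closed : subsemimod_closed test_pred.
Proof.
apply: GRing.submod_closed_semi; split.
  apply/asboolP; split=> [z _|h l _ _]; first exact: derivable_cst.
  exists 0 => _ [z _ <-].
  by rewrite (Normc.normc0 R : Normc.normc ((0 : cplx R -> cplx R) z) = 0) mul0r.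
move=> a u v /asboolP[du bu] /asboolP[dv bv]; apply/asboolP; split=> [z _|h l h0 l0].
  by apply: derivableD; [apply: derivableZ; exact: du|exact: dv].
have [[M hM] [N hN]] := (bu h l h0 l0, bv h l h0 l0).
exists (Normc.normc a * M + N) => _ [z zh <-] /=.
apply: (@le_trans _ _ ((Normc.normc a * Normc.normc (u z) + Normc.normc (v z)) *
   expR (wext w (l * complex.Re z)))).
  rewrite ler_wpM2r ?expR_ge0// -Normc.normcM.
  exact: (@le_normcD R).
rewrite mulrDl -mulrA lerD ?ler_wpM2l//; first by case: (a) => ? ?; exact: sqrtr_ge0.
  by apply: hM; exists z.
by apply: hN; exists z.
Qed.

HB.instance Definition _ :=
  GRing.isSubmodClosed.Build R[i] (cplx R -> cplx R) test_pred test_closed.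

End test_functions.

Record testfun {R : realType} (w : R -> R) := Testfun {
  testfun_val :> cplx R -> cplx R;
  testfunP : testfun_val \in test_pred w }.

Section testfun_structure.
Context {R : realType} (w : R -> R).

HB.instance Definition _ := [isSub for @testfun_val R w].
HB.instance Definition _ := [Choice of testfun w by <:].
HB.instance Definition _ := [SubChoice_isSubLmodule of testfun w by <:].

Definition test_ball (h l e : R) (phi : testfun w) : set (testfun w) :=
  [set psi | test_norm w h l (psi - phi) < e].

Definition test_subbase : set (set (testfun w)) :=
  [set B | exists h l e phi, [/\ 0 < h, 0 < l & B = test_ball h l e phi]].

(* The locally convex topology defined by the norms [test_norm w h l],
   h, l > 0: their open balls form a subbase. *)
HB.instance Definition _ :=
  isSubBaseTopological.Build (testfun w) test_subbase id.

Definition dual_pred : pred (testfun w -> cplx R) :=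
  fun f => `[< linear f /\ continuous f >].

Lemma dual_closed : subsemimod_closed dual_pred.
Proof.
apply: GRing.submod_closed_semi; split.
  apply/asboolP; split=> [a u v|]; last exact: cst_continuous.
  by rewrite /= scaler0 addr0.
move=> a f g /asboolP[lf cf] /asboolP[lg cg]; apply/asboolP; split=> [b u v|x].
  rewrite !fctE lf lg !scalerDr !scalerA mulrC -!addrA; congr (_ + _).
  by rewrite addrCA.
by apply: continuousD; [apply: continuousZl_tmp; exact: cf|exact: cg].
Qed.

HB.instance Definition _ :=
  GRing.isSubmodClosed.Build R[i] (testfun w -> cplx R) dual_pred dual_closed.

End testfun_structure.

Record dual {R : realType} (w : R -> R) := Dual {
  dual_val :> testfun w -> cplx R;
  dualP : dual_val \in @dual_pred R w }.

Section dual_structure.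
Context {R : realType} (w : R -> R).

HB.instance Definition _ := [isSub for @dual_val R w].
HB.instance Definition _ := [Choice of dual w by <:].
HB.instance Definition _ := [SubChoice_isSubLmodule of dual w by <:].

End dual_structure.

Section boundary_values.
Context {R : realType} (w : R -> R).

Definition growth_on (D : set (cplx R)) (l : R) (F : cplx R -> cplx R) :=
  has_ubound
    [set Normc.normc (F z) * expR (- wext w (l * complex.Re z)) | z in D].

(* The integral of G(x + iy) over x in R. *)
Definition line_integral (y : R) (G : cplx R -> cplx R) : cplx R :=
  Rintegral lebesgue_measure setT (fun x => complex.Re (G (x +i* y))) +i*
  Rintegral lebesgue_measure setT (fun x => complex.Im (G (x +i* y))).

(* Gamma_k, counterclockwise: the lower line Im z = -k is run from left to
   right, the upper line Im z = k from right to left. *)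
Definition Gamma_integral (k : R) (G : cplx R -> cplx R) : cplx R :=
  line_integral (- k) G - line_integral k G.

(* [is_bv F f]: bv(F) is defined and equal to f. *)
Definition is_bv (F : cplx R -> cplx R) (f : dual w) :=
  exists b l : R,
    [/\ 0 < b, 0 < l, analytic_on (~` closure (strip b)) F,
        forall r, b < r -> growth_on (strip2 b r) l F &
        forall k, b < k -> forall phi : testfun w,
          f phi = - Gamma_integral k (fun z => F z * phi z)].

End boundary_values.

Section real_support.
Context {R : realType} (w : R -> R).

Definition Ospace_closed (b r l : R) (K : set (\bar R))
    (F : cplx R -> cplx R) :=
  analytic_on (strip2_over b r K°) F /\ growth_on w (strip2_over b r K°) l F.

(* [K] is compact, being closed in the compact space [\bar R]. *)
Definition Ospace_open (h r l : R) (Om : set (\bar R))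
    (F : cplx R -> cplx R) :=
  analytic_on (strip2_over h r Om) F /\
  forall K : set (\bar R),
    closed K -> K <> setT -> K° !=set0 -> K `<=` Om ->
    forall b r' : R, h < b -> b < r' -> r' < r -> Ospace_closed b r' l K F.

Definition Ospace (Om : set (\bar R)) (F : cplx R -> cplx R) :=
  exists l h : R, [/\ 0 < l, 0 < h &
    forall r, h < r -> Ospace_open h r l Om F].

Definition vanishes_on (Om : set (\bar R)) (f : dual w) :=
  exists2 F, Ospace Om F & is_bv F f.

(* The largest open set on which [f] vanishes is written as the union of all
   of them. *)
Definition real_supp (f : dual w) : set (\bar R) :=
  ~` \bigcup_(Om in [set Om | open Om /\ vanishes_on Om f]) Om.

(* U'_(w)[K + iR]; [K] is meant to be closed. *)
Definition dual_supported (K : set (\bar R)) : set (dual w) :=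
  [set f | real_supp f `<=` K].

Definition dual_plus (a : R) : set (dual w) :=
  dual_supported [set x | (a%:E <= x)%E].

Definition dual_minus (b : R) : set (dual w) :=
  dual_supported [set x | (x <= b%:E)%E].

End real_support.

(* Main.v *)
(* Only surjectivity of [lambda] needs work.  A functional [f] satisfies
   [|f phi| <= C sup_{T^h} |phi| e^{w(l x)}], so by Hahn-Banach it extends to a
   functional [L] on arbitrary functions that obeys the same bound.  Multiplying
   by the indicators of [Re zeta >= a] and [Re zeta < a] before applying [L]
   splits [f] into two pieces.  If [U_(w)(C)] is not trivial, it contains [P]
   with [P 0 = 1], and the piece over a set [T] is the boundary value of
     [F z = (2 i pi)^-1 L (zeta |-> 1_T(zeta) P (zeta - z) / (zeta - z))],
   which is analytic off [T] and grows at most like [e^{w(2 l x)}] at a positive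
   distance from [T].  That [bv F] is the piece is Cauchy's formula for
   [P (zeta - z) phi z] on a strip, once [L] is interchanged with the integrals.
   Cauchy's formula for functions that are merely complex differentiable is
   derived from Goursat's theorem for rectangles. *)
Require Import Defs.
From mathcomp Require Import all_boot all_order all_algebra.
From mathcomp Require Import complex.
From mathcomp Require Import all_classical all_reals all_analysis.
From mathcomp Require Import finmap ring lra.
Set Implicit Arguments.
Unset Strict Implicit.
Unset Printing Implicit Defensive.
Import Order.TTheory GRing.Theory Num.Theory.
Import numFieldNormedType.Exports.
Local Open Scope classical_set_scope.
Local Open Scope ring_scope.
Local Open Scope complex_scope.
Local Notation nc := Normc.normc.
Local Notation Re := complex.Re.
Local Notation Im := complex.Im.

(** The obstacle is that a cut at [Re zeta = a] destroys analyticity, so [f] has to be extended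
    before it is cut. It is extended to all functions, not only to continuous or measurable ones, so
    that neither cuts nor pointwise choices leave the domain of [L]. The price is that [L] is not an
    integral: its bound by a weighted supremum is the only means of differentiating under [L] or of
    moving [L] through an integral. This is why Cauchy's formula is turned into Taylor and Lipschitz
    estimates whose constants are uniform in [zeta].

    The factor [P (zeta - z)] is needed since [(zeta - z)^-1] alone does not decay against
    [e^{w(l x)}]; being 1 on the diagonal, it leaves the residue unchanged. The weight at [zeta] is
    at most a weight at [z], which becomes the growth of [F] with [2 l] for [l], times a weight at
    [zeta - z], which [P] absorbs. Condition [cond_delta] yields a factor [(1 + x^2)^-1], which
    makes the integrals over horizontal lines converge with uniformly small tails. *)

Section modulus.
Context {R : realType}.
Implicit Types z t : cplx R.

Lemma normr_normc z : `|z| = (nc z)%:C.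
Proof. by case: z. Qed.

Lemma normc_ge0 z : 0 <= nc z.
Proof. by case: z => x y; exact: sqrtr_ge0. Qed.

Lemma normcB z t : nc (z - t) = nc (t - z).
Proof. by rewrite -opprB normcN. Qed.

Lemma normc_real (x : R) : nc (x%:C : cplx R) = `|x|.
Proof. by rewrite /= expr0n addr0 sqrtr_sqr. Qed.

Lemma normc_imag (y : R) : nc ('i * y%:C : cplx R) = `|y|.
Proof.
by rewrite Normc.normcM normc_real /= expr0n expr1n add0r sqrtr1 mul1r.
Qed.

Lemma normr_Re z : `|Re z| <= nc z.
Proof.
case: z => x y /=; rewrite -sqrtr_sqr ler_sqrt ?addr_ge0 ?sqr_ge0//.
by rewrite lerDl sqr_ge0.
Qed.

Lemma normr_Im z : `|Im z| <= nc z.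
Proof.
case: z => x y /=; rewrite -sqrtr_sqr ler_sqrt ?addr_ge0 ?sqr_ge0//.
by rewrite lerDr sqr_ge0.
Qed.

Lemma normc_le_ReIm z : nc z <= `|Re z| + `|Im z|.
Proof.
rewrite [leLHS](_ : _ = nc ((Re z)%:C + 'i * (Im z)%:C)); last by rewrite -complexE.
by apply: le_trans (le_normcD _ _) _; rewrite normc_real normc_imag.
Qed.

Lemma normc_i : nc ('i : cplx R) = 1.
Proof. by rewrite /= expr0n expr1n add0r sqrtr1. Qed.

Lemma normc_gt0 z : z != 0 -> 0 < nc z.
Proof.
move=> z0; rewrite lt_neqAle normc_ge0 andbT eq_sym.
by apply: contra z0 => /eqP/Normc.eq0_normc ->.
Qed.

Lemma normc_lerB z t : nc z - nc t <= nc (z - t).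
Proof. by rewrite lerBlDr -{1}(subrK t z) le_normcD. Qed.

Lemma RecD z t : Re (z + t) = Re z + Re t. Proof. by case: z t => ? ? []. Qed.
Lemma ImcD z t : Im (z + t) = Im z + Im t. Proof. by case: z t => ? ? []. Qed.
Lemma RecN z : Re (- z) = - Re z. Proof. by case: z. Qed.
Lemma ImcN z : Im (- z) = - Im z. Proof. by case: z. Qed.
Lemma RecM z t : Re (z * t) = Re z * Re t - Im z * Im t.
Proof. by case: z t => ? ? []. Qed.
Lemma ImcM z t : Im (z * t) = Re z * Im t + Im z * Re t.
Proof. by case: z t => ? ? []. Qed.

(** The norm of [cplx R] takes values in [R[i]], where a positive element is a positive real [e]
    seen as [e%:C]; so the usual radii may be taken in [R]. *)
Lemma normc_cvgP {T : Type} {F : set_system T} {FF : Filter F} (f : T -> cplx R)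
    (l : cplx R) :
  (forall e : R, 0 < e -> \forall x \near F, nc (f x - l) < e) <-> f @ F --> l.
Proof.
split=> [H|H e e0].
  apply/cvgrPdist_lt => e e0.
  have e0' : 0 < Re e by move: e0; rewrite ltcE => /andP[].
  have eE : e = (Re e)%:C by rewrite RRe_real// ger0_real// ltW.
  move: (H _ e0'); apply: filterS => x.
  by rewrite distrC normr_normc eE ltcR.
move/cvgrPdist_lt : H => /(_ e%:C); rewrite ltcR => /(_ e0).
by apply: filterS => x; rewrite distrC normr_normc ltcR.
Qed.

Lemma normc_nbhsP (z : cplx R) (P : set (cplx R)) :
  (exists2 d : R, 0 < d & forall t, nc (t - z) < d -> P t) <-> nbhs z P.
Proof.
split=> [[d d0 H]|].
  apply/nbhs_ballP; exists d%:C; first by rewrite /= ltcR.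
  by move=> t; rewrite -ball_normE /= distrC normr_normc ltcR => /H.
move=> /nbhs_ballP[e /= e0 H].
have eE : e = (Re e)%:C by rewrite RRe_real// ger0_real// ltW.
exists (Re e); first by move: e0; rewrite ltcE => /andP[].
by move=> t tz; apply: H; rewrite -ball_normE /= distrC normr_normc eE ltcR.
Qed.

(** The difference quotient multiplied out, which includes [t = 0] and is the form consumed by the
    local step of Goursat's argument. *)
Lemma derivable_normc (F : cplx R -> cplx R) z : derivable F z 1 ->
  exists D : cplx R, forall e : R, 0 < e -> exists2 d : R, 0 < d &
    forall t, nc t < d -> nc (F (z + t) - F z - D * t) <= e * nc t.
Proof.
rewrite /derivable => /cvg_ex[/= D H]; exists D => e e0.
move/normc_cvgP : H => /(_ e e0).
rewrite /dnbhs /within /= => /normc_nbhsP[d d0 H]; exists d => // t td.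
have [->|t0] := eqVneq t 0.
  by rewrite addr0 subrr mulr0 subr0 !(Normc.normc0 R) mulr0.
have := H t; rewrite subr0 => /(_ td t0).
rewrite -ler_pdivrMr ?normc_gt0// -Normc.normcV -Normc.normcM => /ltW.
congr (_ <= _); congr nc.
by rewrite -[t%:A]/(t * 1) mulr1 [t + z]addrC -[_ *: _]/(_ * _) [RHS]mulrBl mulfK// mulrC.
Qed.

Lemma normc_derivable (F : cplx R -> cplx R) z (D : cplx R) :
  (forall e : R, 0 < e -> exists2 d : R, 0 < d &
    forall t, nc t < d -> nc (F (z + t) - F z - D * t) <= e * nc t) ->
  derivable F z 1.
Proof.
move=> H; apply/cvg_ex; exists D; apply/normc_cvgP => e e0.
have e20 : 0 < e / 2 by rewrite divr_gt0.
have [d d0 {}H] := H _ e20.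
rewrite /dnbhs /within /=; apply/normc_nbhsP; exists d => // t.
rewrite subr0 => td t0; have := H t td.
rewrite -ler_pdivrMr ?normc_gt0// -Normc.normcV -Normc.normcM => H'.
apply: (@le_lt_trans _ _ (e / 2)); last by rewrite ltr_pdivrMr// ltr_pMr ?ltr1n.
move: H'; congr (_ <= _); congr nc.
by rewrite -[t%:A]/(t * 1) mulr1 [t + z]addrC -[_ *: _]/(_ * _) [LHS]mulrBl mulfK// mulrC.
Qed.

Lemma continuous_Re : continuous (@complex.Re R : cplx R -> R).
Proof.
move=> z; apply/(@cvgrPdist_lt _ _ _ (nbhs (z : cplx R)) (nbhs_filter z)) => e e0.
apply/normc_nbhsP; exists e => // t tz.
by rewrite -RecN -RecD (le_lt_trans (normr_Re _))// normcB.
Qed.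

Lemma continuous_Im : continuous (@complex.Im R : cplx R -> R).
Proof.
move=> z; apply/(@cvgrPdist_lt _ _ _ (nbhs (z : cplx R)) (nbhs_filter z)) => e e0.
apply/normc_nbhsP; exists e => // t tz.
by rewrite -ImcN -ImcD (le_lt_trans (normr_Im _))// normcB.
Qed.

Lemma continuous_complex (f g : R -> R) x :
  {for x, continuous f} -> {for x, continuous g} ->
  {for x, continuous (fun u => f u +i* g u : cplx R)}.
Proof.
move=> fx gx; apply/normc_cvgP => e e0.
have e20 : 0 < e / 2 by rewrite divr_gt0.
move/cvgrPdist_lt : fx => /(_ _ e20) fx.
move/cvgrPdist_lt : gx => /(_ _ e20) gx.
near=> u.
apply: le_lt_trans (normc_le_ReIm _) _ => /=.
rewrite [ltRHS]splitr distrC [X in _ + X]distrC ltrD//.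
  by near: u.
by near: u.
Unshelve. all: by end_near. Qed.

Lemma continuous_hline (y : R) : continuous (fun x : R => x +i* y : cplx R).
Proof. by move=> x; apply: continuous_complex => //; exact: cvg_cst. Qed.

Lemma continuous_vline (x : R) : continuous (fun y : R => x +i* y : cplx R).
Proof. by move=> y; apply: continuous_complex => //; exact: cvg_cst. Qed.

Lemma derivable_continuous (F : cplx R -> cplx R) z :
  derivable F z 1 -> {for z, continuous F}.
Proof. by move/derivable1_diffP; exact: differentiable_continuous. Qed.

Lemma derivable_chain (F G : cplx R -> cplx R) z :
  derivable F (G z) 1 -> derivable G z 1 -> derivable (fun u => F (G u)) z 1.
Proof.
move=> /derivable1_diffP dF /derivable1_diffP dG.
apply/derivable1_diffP; exact: (@differentiable_comp _ _ _ _ G F z dG dF).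
Qed.

End modulus.

(** * Complex-valued integrals *)

Section complex_integral.
Context {R : realType}.
Local Notation mu := (@lebesgue_measure R).
Implicit Types (D : set R) (f g : R -> cplx R) (a b c : R).

Definition cintegrable D g :=
  mu.-integrable D (fun x => (Re (g x))%:E) /\
  mu.-integrable D (fun x => (Im (g x))%:E).

(** Shaped like [line_integral], so that the two terms of [Gamma_integral] are integrals
    [cRint setT] by conversion. *)
Definition cRint D g : cplx R :=
  Rintegral mu D (fun x => Re (g x)) +i* Rintegral mu D (fun x => Im (g x)).

Lemma eq_cRint D f g : (forall x, D x -> f x = g x) -> cRint D f = cRint D g.
Proof.
by move=> fg; congr (_ +i* _); apply: eq_Rintegral => x /set_mem Dx; rewrite fg.
Qed.

Lemma cintegrableD D f g : measurable D -> cintegrable D f -> cintegrable D g ->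
  cintegrable D (fun x => f x + g x).
Proof.
move=> mD [f1 f2] [g1 g2]; split.
  by under eq_fun do rewrite RecD EFinD; exact: integrableD.
by under eq_fun do rewrite ImcD EFinD; exact: integrableD.
Qed.

Lemma cintegrableZ D (k : cplx R) g : measurable D -> cintegrable D g ->
  cintegrable D (fun x => k * g x).
Proof.
move=> mD [g1 g2]; split.
  under eq_fun do rewrite RecM EFinB 2!EFinM.
  by apply: integrableB => //; exact: integrableZl.
under eq_fun do rewrite ImcM EFinD 2!EFinM.
by apply: integrableD => //; exact: integrableZl.
Qed.

Lemma integrable_EFinZl D (k : R) (h : R -> R) : measurable D ->
  mu.-integrable D (EFin \o h) -> mu.-integrable D (EFin \o (fun x => k * h x)).
Proof.
move=> mD Ih; rewrite (_ : _ \o _ = fun x => (k%:E * (h x)%:E)%E)//.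
exact: integrableZl.
Qed.

Lemma cRintD D f g : measurable D -> cintegrable D f -> cintegrable D g ->
  cRint D (fun x => f x + g x) = cRint D f + cRint D g.
Proof.
move=> mD [f1 f2] [g1 g2]; apply/eqP; rewrite eq_complex; apply/andP; split; apply/eqP => /=.
  by under eq_Rintegral do rewrite RecD; rewrite RintegralD.
by under eq_Rintegral do rewrite ImcD; rewrite RintegralD.
Qed.

Lemma cRintZ D (k : cplx R) g : measurable D -> cintegrable D g ->
  cRint D (fun x => k * g x) = k * cRint D g.
Proof.
move=> mD [g1 g2]; apply/eqP; rewrite eq_complex; apply/andP; split; apply/eqP.
  rewrite RecM /=; under eq_Rintegral do rewrite RecM.
  by rewrite RintegralB ?RintegralZl//; exact: integrable_EFinZl.
rewrite ImcM /=; under eq_Rintegral do rewrite ImcM.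
by rewrite RintegralD ?RintegralZl//; exact: integrable_EFinZl.
Qed.

Lemma cRintB D f g : measurable D -> cintegrable D f -> cintegrable D g ->
  cRint D (fun x => f x - g x) = cRint D f - cRint D g.
Proof.
move=> mD If Ig; rewrite -[- cRint D g]mulN1r -cRintZ// -cRintD//; last exact: cintegrableZ.
by apply: eq_cRint => x _; rewrite mulN1r.
Qed.

Lemma cintegrableB D f g : measurable D -> cintegrable D f -> cintegrable D g ->
  cintegrable D (fun x => f x - g x).
Proof.
move=> mD If Ig; under [X in cintegrable D X]eq_fun do rewrite -[- g _]mulN1r.
by apply: cintegrableD => //; exact: cintegrableZ.
Qed.

(** Real and imaginary parts are estimated separately, whence the factor 2; a sharp constant would
    require rotating the integral onto the positive axis. *)
Lemma normc_cRint D g (m : R -> R) : measurable D -> cintegrable D g ->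
  mu.-integrable D (EFin \o m) -> (forall x, D x -> nc (g x) <= m x) ->
  nc (cRint D g) <= 2 * Rintegral mu D m.
Proof.
move=> mD [g1 g2] Im gm; apply: le_trans (normc_le_ReIm _) _ => /=.
rewrite mulr2n mulrDl !mul1r lerD//; apply: le_trans (le_normr_Rintegral _ _) _ => //;
  apply: le_Rintegral => //; try exact: (integrable_norm _).
  by move=> x Dx; apply: le_trans (normr_Re _) (gm _ Dx).
by move=> x Dx; apply: le_trans (normr_Im _) (gm _ Dx).
Qed.

Lemma normc_cRint_itv a b g M : a <= b -> cintegrable `[a, b] g ->
  (forall x, a <= x <= b -> nc (g x) <= M) ->
  nc (cRint `[a, b] g) <= 2 * M * (b - a).
Proof.
move=> ab Ig gM.
apply: le_trans (@normc_cRint _ _ (cst M) _ Ig _ _) _ => //.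
- apply: continuous_compact_integrable; first exact: segment_compact.
  by apply: continuous_subspaceT => x; exact: cst_continuous.
- rewrite Rintegral_cst//= lebesgue_measure_itv /= lte_fin.
  have [ab'|] := ltP a b; first by rewrite /= mulrA.
  move=> ba; have -> : b = a by lra.
  rewrite subrr mulr0 !mulr0. exact: lexx.
Qed.

Lemma cRint_cst a b (k : cplx R) : a <= b ->
  cRint `[a, b] (fun=> k) = (b - a)%:C * k.
Proof.
move=> ab; rewrite /cRint !Rintegral_cst//= lebesgue_measure_itv /= lte_fin.
case: k => k1 k2; apply/eqP; rewrite eq_complex /= !mul0r subr0 addr0.
have [ab'|] := ltP a b; first by rewrite /= ![_ * (b - a)]mulrC !eqxx.
move=> ba; have -> : b = a by lra. rewrite subrr !mulr0 !mul0r.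
by rewrite !eqxx.
Qed.

Lemma cintegrable_continuous a b g :
  (forall x, a <= x <= b -> {for x, continuous g}) -> cintegrable `[a, b] g.
Proof.
move=> cg; split; (apply: continuous_compact_integrable; first exact: segment_compact);
  apply: continuous_in_subspaceT => x /set_mem /=; rewrite in_itv/= => xab.
  by apply: (@continuous_comp _ (cplx R) _ g (@complex.Re R));
    [exact: cg|exact: continuous_Re].
by apply: (@continuous_comp _ (cplx R) _ g (@complex.Im R));
    [exact: cg|exact: continuous_Im].
Qed.

Lemma Rintegral_itv_split a b c (h : R -> R) : a <= b -> b <= c ->
  mu.-integrable `[a, c] (EFin \o h) ->
  Rintegral mu `[a, c] h = Rintegral mu `[a, b] h + Rintegral mu `[b, c] h.
Proof.
move=> ab bc Ih; apply/eqP; rewrite addrC -subr_eq; apply/eqP.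
rewrite (@Rintegral_itvB _ _ (BLeft a) (BRight c) b) ?bnd_simp//.
apply: Rintegral_itv_obnd_cbnd; apply: integrableS Ih => //.
by move=> x /=; rewrite !in_itv/= => /andP[/ltW/(le_trans ab)-> ->].
Qed.

Lemma cRint_split a b c g : a <= b -> b <= c -> cintegrable `[a, c] g ->
  cRint `[a, c] g = cRint `[a, b] g + cRint `[b, c] g.
Proof.
move=> ab bc [g1 g2]; apply/eqP; rewrite eq_complex; apply/andP.
by split; apply/eqP; exact: Rintegral_itv_split.
Qed.

End complex_integral.

(** * Goursat's theorem and Cauchy's formula *)

Section bisection.
Context {R : realType}.
Implicit Types (P : R -> R -> R -> R -> Prop) (x y p q : R).

Lemma nested_point (x p : nat -> R) :
  (forall n, 0 <= p n) -> (forall n, x n <= x n.+1) ->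
  (forall n, x n.+1 + p n.+1 <= x n + p n) ->
  exists a, forall n, x n <= a <= x n + p n.
Proof.
move=> p0 xS xpS.
have xle m n : (m <= n)%N -> x m <= x n.
  by move=> /subnK <-; elim: (n - m)%N => // k IH; exact: le_trans IH (xS _).
have xple m n : (m <= n)%N -> x n + p n <= x m + p m.
  by move=> /subnK <-; elim: (n - m)%N => // k IH; exact: le_trans (xpS _) IH.
have xxp m n : x m <= x n + p n.
  have [mn|/ltnW nm] := leqP m n.
    by apply: le_trans (xle _ _ mn) _; rewrite lerDl.
  by apply: le_trans _ (xple _ _ nm); rewrite lerDl.
exists (sup (range x)) => n; apply/andP; split.
  apply: ub_le_sup; last by exists n.
  by exists (x 0%N + p 0%N) => _ [m _ <-].
by apply: ge_sup; [exists (x 0%N), 0%N|move=> _ [m _ <-]].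
Qed.

(** A Cousin lemma for rectangles. If [P] failed, some quarter of every bad rectangle would be bad,
    and the nested bad rectangles would shrink to a point [(a, b)] around which the second
    hypothesis excludes them. *)
Lemma rectangle_bisection P x p y q : 0 <= p -> 0 <= q ->
  (forall x1 x2 y1 y2, x1 <= x2 -> y1 <= y2 ->
    let x0 := (x1 + x2) / 2 in let y0 := (y1 + y2) / 2 in
    P x1 x0 y1 y0 -> P x0 x2 y1 y0 -> P x1 x0 y0 y2 -> P x0 x2 y0 y2 ->
    P x1 x2 y1 y2) ->
  (forall a b, x <= a <= x + p -> y <= b <= y + q ->
    exists2 d, 0 < d & forall x1 x2 y1 y2,
      x1 <= a <= x2 -> y1 <= b <= y2 -> x2 - x1 < d -> y2 - y1 < d ->
      x <= x1 -> x2 <= x + p -> y <= y1 -> y2 <= y + q ->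
      P x1 x2 y1 y2) ->
  P x (x + p) y (y + q).
Proof.
move=> p0 q0 Psplit Ploc; apply: contrapT => nP.
(* A rectangle of generation [n] has sides [p / 2 ^+ n] and [q / 2 ^+ n], so its lower left corner
   determines it. *)
pose bad n (s : R * R) :=
  ~ P s.1 (s.1 + p / 2 ^+ n) s.2 (s.2 + q / 2 ^+ n).
pose nxt n (s s' : R * R) := [/\ bad n.+1 s', s.1 <= s'.1, s.2 <= s'.2,
  s'.1 + p / 2 ^+ n.+1 <= s.1 + p / 2 ^+ n &
  s'.2 + q / 2 ^+ n.+1 <= s.2 + q / 2 ^+ n].
have halve (r : R) n : r / 2 ^+ n = r / 2 ^+ n.+1 + r / 2 ^+ n.+1.
  by rewrite exprS; field; rewrite expf_neq0.
have pn0 n : 0 <= p / 2 ^+ n by rewrite divr_ge0// exprn_ge0.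
have qn0 n : 0 <= q / 2 ^+ n by rewrite divr_ge0// exprn_ge0.
have step n s : bad n s -> exists s', nxt n s s'.
  move=> bs; apply: contrapT => /forallNP H; apply: bs.
  have [] := (pn0 n.+1, qn0 n.+1); rewrite (halve p n) (halve q n).
  move: H; rewrite /nxt /bad (halve p n) (halve q n); move: (p / _ ^+ n.+1) (q / _ ^+ n.+1) => p' q' H p'0 q'0.
  have mid (u r : R) : (u + (u + (r + r))) / 2 = u + r by field.
  have ass (u r : R) : u + (r + r) = u + r + r by rewrite addrA.
  apply: Psplit; rewrite ?lerDl ?addr_ge0// ?mid ?ass.
  - by apply: contrapT => n1; apply: (H (s.1, s.2)); split => //=; lra.
  - by apply: contrapT => n1; apply: (H (s.1 + p', s.2)); split => //=; lra.
  - by apply: contrapT => n1; apply: (H (s.1, s.2 + q')); split => //=; lra.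
  - by apply: contrapT => n1; apply: (H (s.1 + p', s.2 + q')); split => //=; lra.
pose next n s := xget s [set s' | nxt n s s'].
pose fix S n := if n is m.+1 then next m (S m) else (x, y).
have badS n : bad n (S n).
  elim: n => [|n IH]; first by rewrite /bad /= expr0 !divr1.
  have [s' ns'] := step _ _ IH.
  by have [] : nxt n (S n) (S n.+1) by rewrite /= /next; case: xgetP => // /(_ s').
have nxtS n : nxt n (S n) (S n.+1).
  have [s' ns'] := step _ _ (badS n).
  by rewrite /= /next; case: xgetP => // /(_ s').
have [a Ha] := @nested_point (fun n => (S n).1) (fun n => p / 2 ^+ n) pn0
  (fun n => let: And5 _ h _ _ _ := nxtS n in h)
  (fun n => let: And5 _ _ _ h _ := nxtS n in h).
have [b Hb] := @nested_point (fun n => (S n).2) (fun n => q / 2 ^+ n) qn0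
  (fun n => let: And5 _ _ h _ _ := nxtS n in h)
  (fun n => let: And5 _ _ _ _ h := nxtS n in h).
have [xa yb] := (Ha 0%N, Hb 0%N); rewrite /= expr0 !divr1 in xa yb.
have [d d0 Hd] := Ploc a b xa yb.
have [n nd] : exists n, (p + q) / 2 ^+ n < d.
  have [n Hn] : exists n, (p + q) / d < n%:R.
    by exists (Num.trunc ((p + q) / d)).+1; rewrite truncnS_gt.
  exists n; rewrite ltr_pdivrMr ?exprn_gt0//.
  move: Hn; rewrite ltr_pdivrMr// => /lt_le_trans; apply.
  by rewrite mulrC ler_pM2l// -natrX ler_nat ltnW// ltn_expl.
have inv n' : [/\ x <= (S n').1, (S n').1 + p / 2 ^+ n' <= x + p,
   y <= (S n').2 & (S n').2 + q / 2 ^+ n' <= y + q].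
  elim: n' => [|m [i1 i2 i3 i4]]; first by rewrite /= expr0 !divr1.
  have [_ j1 j2 j3 j4] := nxtS m; split; [exact: le_trans i1 j1|exact: le_trans j3 i2|
    exact: le_trans i3 j2|exact: le_trans j4 i4].
have [i1 i2 i3 i4] := inv n.
rewrite mulrDl in nd.
have [pn qn] := (pn0 n, qn0 n).
by apply: (badS n); apply: Hd => //; rewrite addrAC subrr add0r; lra.
Qed.

End bisection.

Section goursat.
Context {R : realType}.
Implicit Types (G : cplx R -> cplx R) (x y : R) (z : cplx R).

(** The counterclockwise contour integral: bottom minus top, plus ['i] times right minus left
    because [dz = i dy] on vertical sides. *)
Definition rect_int x1 x2 y1 y2 G : cplx R :=
  cRint `[x1, x2] (fun x => G (x +i* y1)) - cRint `[x1, x2] (fun x => G (x +i* y2))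
  + 'i * (cRint `[y1, y2] (fun y => G (x2 +i* y)) - cRint `[y1, y2] (fun y => G (x1 +i* y))).

Definition in_rect x1 x2 y1 y2 z := x1 <= Re z <= x2 /\ y1 <= Im z <= y2.

Definition on_rect x1 x2 y1 y2 z := in_rect x1 x2 y1 y2 z /\
  [\/ Re z = x1, Re z = x2, Im z = y1 | Im z = y2].

Lemma cintegrable_hline x1 x2 y G :
  (forall x, x1 <= x <= x2 -> {for (x +i* y : cplx R), continuous G}) ->
  cintegrable `[x1, x2] (fun x => G (x +i* y)).
Proof.
move=> cG; apply: cintegrable_continuous => x xx.
apply: (@continuous_comp _ _ _ (fun x : R => x +i* y : cplx R) G).
  exact: continuous_hline.
exact: cG.
Qed.

Lemma cintegrable_vline y1 y2 x G :
  (forall y, y1 <= y <= y2 -> {for (x +i* y : cplx R), continuous G}) ->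
  cintegrable `[y1, y2] (fun y => G (x +i* y)).
Proof.
move=> cG; apply: cintegrable_continuous => y yy.
apply: (@continuous_comp _ _ _ (fun y : R => x +i* y : cplx R) G).
  exact: continuous_vline.
exact: cG.
Qed.

Section sides.
Variables (x1 x2 y1 y2 : R).
Hypotheses (x12 : x1 <= x2) (y12 : y1 <= y2).

Lemma on_rect_sides (Q : cplx R -> Prop) :
  (forall z, on_rect x1 x2 y1 y2 z -> Q z) ->
  [/\ forall x, x1 <= x <= x2 -> Q (x +i* y1),
      forall x, x1 <= x <= x2 -> Q (x +i* y2),
      forall y, y1 <= y <= y2 -> Q (x1 +i* y) &
      forall y, y1 <= y <= y2 -> Q (x2 +i* y)].
Proof.
move=> H; split=> u uu; apply: H; rewrite /on_rect /in_rect /= ?uu ?lexx ?x12 ?y12; split=> //;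
  by [constructor 1|constructor 2|constructor 3|constructor 4].
Qed.

Lemma cintegrable_sides G : (forall z, on_rect x1 x2 y1 y2 z -> {for z, continuous G}) ->
  [/\ cintegrable `[x1, x2] (fun x => G (x +i* y1)),
      cintegrable `[x1, x2] (fun x => G (x +i* y2)),
      cintegrable `[y1, y2] (fun y => G (x1 +i* y)) &
      cintegrable `[y1, y2] (fun y => G (x2 +i* y))].
Proof.
move=> /on_rect_sides[h1 h2 h3 h4].
by split; [exact: cintegrable_hline|exact: cintegrable_hline|
  exact: cintegrable_vline|exact: cintegrable_vline].
Qed.

Lemma eq_rect_int G H : (forall z, on_rect x1 x2 y1 y2 z -> G z = H z) ->
  rect_int x1 x2 y1 y2 G = rect_int x1 x2 y1 y2 H.
Proof.
move=> /on_rect_sides[h1 h2 h3 h4]; rewrite /rect_int.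
congr (_ - _ + _ * (_ - _)); apply: eq_cRint => u /=; rewrite in_itv/=.
- exact: h1.
- exact: h2.
- exact: h4.
- exact: h3.
Qed.

Lemma rect_intD G H :
  (forall z, on_rect x1 x2 y1 y2 z -> {for z, continuous G}) ->
  (forall z, on_rect x1 x2 y1 y2 z -> {for z, continuous H}) ->
  rect_int x1 x2 y1 y2 (fun z => G z + H z) =
  rect_int x1 x2 y1 y2 G + rect_int x1 x2 y1 y2 H.
Proof.
move=> /cintegrable_sides[g1 g2 g3 g4] /cintegrable_sides[h1 h2 h3 h4].
rewrite /rect_int !cRintD//.
set a1 := cRint _ _; set a2 := cRint _ _; set a3 := cRint _ _; set a4 := cRint _ _.
set a5 := cRint _ _; set a6 := cRint _ _; set a7 := cRint _ _; set a8 := cRint _ _.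
by ring.
Qed.

Lemma rect_intZ (k : cplx R) G :
  (forall z, on_rect x1 x2 y1 y2 z -> {for z, continuous G}) ->
  rect_int x1 x2 y1 y2 (fun z => k * G z) = k * rect_int x1 x2 y1 y2 G.
Proof.
move=> /cintegrable_sides[g1 g2 g3 g4].
rewrite /rect_int !cRintZ//.
set a1 := cRint _ _; set a2 := cRint _ _; set a3 := cRint _ _; set a4 := cRint _ _.
by ring.
Qed.

Lemma rect_int_bound G (M : R) :
  (forall z, on_rect x1 x2 y1 y2 z -> {for z, continuous G}) ->
  (forall z, on_rect x1 x2 y1 y2 z -> nc (G z) <= M) ->
  nc (rect_int x1 x2 y1 y2 G) <= 4 * M * ((x2 - x1) + (y2 - y1)).
Proof.
move=> /cintegrable_sides[g1 g2 g3 g4] /on_rect_sides[h1 h2 h3 h4].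
have b1 := normc_cRint_itv x12 g1 h1.
have b2 := normc_cRint_itv x12 g2 h2.
have b3 := normc_cRint_itv y12 g3 h3.
have b4 := normc_cRint_itv y12 g4 h4.
rewrite /rect_int.
apply: le_trans (le_normcD _ _) _.
rewrite Normc.normcM normc_i mul1r.
have tB (u v : cplx R) : nc (u - v) <= nc u + nc v.
  by apply: le_trans (le_normcD _ _) _; rewrite normcN.
apply: le_trans (lerD (tB _ _) (tB _ _)) _.
lra.
Qed.

(** On opposite sides the integrands differ by a constant, and the two constants, each multiplied by
    the length of its sides, cancel. This stands in for the existence of an antiderivative. *)
Lemma rect_int_affine (A B : cplx R) : rect_int x1 x2 y1 y2 (fun z => A + B * z) = 0.
Proof.
have cA z : {for z, continuous (fun z : cplx R => A + B * z)}.
  apply: derivable_continuous; apply: derivableD; first exact: derivable_cst.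
  by apply: derivableM; [exact: derivable_cst|exact: derivable_id].
have [] := @cintegrable_sides (fun z => A + B * z) (fun z _ => cA z) => g1 g2 g3 g4.
rewrite /rect_int -!cRintB//.
rewrite (@eq_cRint _ _ _ (fun=> B * ('i * (y1 - y2)%:C))); last first.
  move=> x _; rewrite opprD addrACA subrr add0r -mulrBr; congr (_ * _).
  by apply/eqP; rewrite eq_complex /=; apply/andP; split; apply/eqP; ring.
rewrite (@eq_cRint _ `[y1, y2] _ (fun=> B * (x2 - x1)%:C)); last first.
  move=> y _; rewrite opprD addrACA subrr add0r -mulrBr; congr (_ * _).
  by apply/eqP; rewrite eq_complex /=; apply/andP; split; apply/eqP; ring.
rewrite !cRint_cst//; rewrite !rmorphB /=; ring.
Qed.

End sides.

Lemma rect_int_split_re x1 x x2 y1 y2 G : x1 <= x -> x <= x2 ->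
  cintegrable `[x1, x2] (fun x => G (x +i* y1)) ->
  cintegrable `[x1, x2] (fun x => G (x +i* y2)) ->
  rect_int x1 x2 y1 y2 G = rect_int x1 x y1 y2 G + rect_int x x2 y1 y2 G.
Proof.
move=> x1x xx2 g1 g2; rewrite /rect_int (cRint_split x1x xx2 g1) (cRint_split x1x xx2 g2).
set a1 := cRint _ _; set a2 := cRint _ _; set a3 := cRint _ _; set a4 := cRint _ _.
set a5 := cRint _ _; set a6 := cRint _ _; set a7 := cRint _ _.
by ring.
Qed.

Lemma rect_int_split_im x1 x2 y1 y y2 G : y1 <= y -> y <= y2 ->
  cintegrable `[y1, y2] (fun y => G (x1 +i* y)) ->
  cintegrable `[y1, y2] (fun y => G (x2 +i* y)) ->
  rect_int x1 x2 y1 y2 G = rect_int x1 x2 y1 y G + rect_int x1 x2 y y2 G.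
Proof.
move=> y1y yy2 g1 g2; rewrite /rect_int (cRint_split y1y yy2 g1) (cRint_split y1y yy2 g2).
set a1 := cRint _ _; set a2 := cRint _ _; set a3 := cRint _ _; set a4 := cRint _ _.
set a5 := cRint _ _; set a6 := cRint _ _; set a7 := cRint _ _.
by ring.
Qed.

(** The bound by [4 * e] times the square of half the perimeter is stable under quartering: each
    quarter has half the perimeter, so the four bounds add up to the original one. Near a point it
    holds because the affine part of [G] integrates to zero and the remainder is at most [e] times
    the distance to the point. *)
Lemma goursat x1 x2 y1 y2 G : x1 <= x2 -> y1 <= y2 ->
  (forall z, in_rect x1 x2 y1 y2 z -> derivable G z 1) ->
  rect_int x1 x2 y1 y2 G = 0.
Proof.
move=> x12 y12 dG; apply: Normc.eq0_normc; apply/eqP; rewrite eq_le normc_ge0 andbT.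
pose K := (x2 - x1 + (y2 - y1)) ^+ 2.
have K0 : 0 <= K by exact: sqr_ge0.
suff H e : 0 < e -> nc (rect_int x1 x2 y1 y2 G) <= 4 * e * K.
  apply/ler_addgt0Pr => e e0; rewrite add0r.
  have K1 : 0 < 4 * (K + 1) by lra.
  apply: le_trans (H (e / (4 * (K + 1))) _) _; first by rewrite divr_gt0.
  rewrite mulrAC mulrA ler_pdivrMr// mulrC ler_pM2l//; lra.
(* The bisection principle ranges over all rectangles, so [P] itself carries the inclusion in the
   given one, where [G] is derivable. *)
move=> e0; pose P u1 u2 v1 v2 := x1 <= u1 -> u2 <= x2 -> y1 <= v1 -> v2 <= y2 ->
  nc (rect_int u1 u2 v1 v2 G) <= 4 * e * (u2 - u1 + (v2 - v1)) ^+ 2.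
have cG z : in_rect x1 x2 y1 y2 z -> {for z, continuous G}.
  by move=> zr; apply: derivable_continuous; exact: dG.
have addBK (u v : R) : u + (v - u) = v by rewrite addrC subrK.
suff : P x1 (x1 + (x2 - x1)) y1 (y1 + (y2 - y1)).
  by rewrite /P !addBK; apply.
apply: (@rectangle_bisection _ P); rewrite ?subr_ge0//.
  move=> u1 u2 v1 v2 u12 v12 u0 v0 P1 P2 P3 P4 xu ux yv vy.
  have [hu1 hu2] : u1 <= u0 /\ u0 <= u2 by rewrite /u0; lra.
  have [hv1 hv2] : v1 <= v0 /\ v0 <= v2 by rewrite /v0; lra.
  have ch v : v1 <= v <= v2 -> forall a b, u1 <= a -> b <= u2 ->
      cintegrable `[a, b] (fun x => G (x +i* v)).
    move=> vv a b ua bu; apply: cintegrable_hline => x xab; apply: cG.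
    by rewrite /in_rect /=; lra.
  have cv u : u1 <= u <= u2 -> cintegrable `[v1, v2] (fun y => G (u +i* y)).
    by move=> uu; apply: cintegrable_vline => y yab; apply: cG; rewrite /in_rect /=; lra.
  rewrite (rect_int_split_im hv1 hv2); [|by apply: cv; lra|by apply: cv; lra].
  rewrite (rect_int_split_re hu1 hu2); [|by apply: ch; lra|by apply: ch; lra].
  rewrite [X in _ + X](rect_int_split_re hu1 hu2); [|by apply: ch; lra|by apply: ch; lra].
  have {}P1 := P1 xu (le_trans hu2 ux) yv (le_trans hv2 vy).
  have {}P2 := P2 (le_trans xu hu1) ux yv (le_trans hv2 vy).
  have {}P3 := P3 xu (le_trans hu2 ux) (le_trans yv hv1) vy.
  have {}P4 := P4 (le_trans xu hu1) ux (le_trans yv hv1) vy.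
  apply: le_trans (le_normcD _ _) _.
  apply: le_trans (lerD (le_normcD _ _) (le_normcD _ _)) _.
  have -> : 4 * e * (u2 - u1 + (v2 - v1)) ^+ 2 =
     4 * (4 * e * ((u2 - u1 + (v2 - v1)) / 2) ^+ 2) by field.
  have e1 : u0 - u1 + (v0 - v1) = (u2 - u1 + (v2 - v1)) / 2 by rewrite /u0 /v0; field.
  have e2 : u2 - u0 + (v0 - v1) = (u2 - u1 + (v2 - v1)) / 2 by rewrite /u0 /v0; field.
  have e3 : u0 - u1 + (v2 - v0) = (u2 - u1 + (v2 - v1)) / 2 by rewrite /u0 /v0; field.
  have e4 : u2 - u0 + (v2 - v0) = (u2 - u1 + (v2 - v1)) / 2 by rewrite /u0 /v0; field.
  rewrite e1 in P1; rewrite e2 in P2; rewrite e3 in P3; rewrite e4 in P4.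
  apply: le_trans (lerD (lerD P1 P2) (lerD P3 P4)) _.
  by rewrite le_eqVlt; apply/orP; left; apply/eqP; ring.
move=> a b; rewrite !addBK => xa yb.
have /derivable_normc[D /(_ e e0)[d d0 Hd]] : derivable G (a +i* b) 1 by exact: dG.
(* Two sides shorter than [d / 2] keep every boundary point within distance [d] of [a +i* b]. *)
exists (d / 2); first by rewrite divr_gt0.
move=> u1 u2 v1 v2 ua vb ud vd xu ux yv vy _ _ _ _.
have u12 : u1 <= u2 by lra.
have v12 : v1 <= v2 by lra.
pose A := G (a +i* b) - D * (a +i* b).
have sub z : on_rect u1 u2 v1 v2 z -> in_rect x1 x2 y1 y2 z.
  by case; rewrite /in_rect => -[h1 h2] _; lra.
have cA z : {for z, continuous (fun z : cplx R => A + D * z)}.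
  apply: derivable_continuous; apply: derivableD; first exact: derivable_cst.
  by apply: derivableM; [exact: derivable_cst|exact: derivable_id].
have cN z : {for z, continuous (fun z : cplx R => -1 * (A + D * z))}.
  by apply: continuousM; [exact: cst_continuous|exact: cA].
have -> : rect_int u1 u2 v1 v2 G =
    rect_int u1 u2 v1 v2 (fun z => G z + -1 * (A + D * z)).
  have E0 : rect_int u1 u2 v1 v2 (fun z => -1 * (A + D * z)) = 0.
    apply: etrans (rect_intZ u12 v12 (-1) (fun z _ => cA z)) _.
    exact: etrans (congr1 _ (rect_int_affine u12 v12 A D)) (mulr0 _).
  apply/esym; apply: etrans (rect_intD u12 v12 (fun z zr => cG z (sub z zr)) (fun z _ => cN z)) _.
  exact: etrans (congr1 (fun u => _ + u) E0) (addr0 _).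
apply: le_trans (@rect_int_bound _ _ _ _ u12 v12 _ (e * (u2 - u1 + (v2 - v1))) _ _) _.
- by move=> z /sub zr; apply: continuousD; [exact: cG|exact: cN].
- move=> z [[h1 h2] _].
  have zs : nc (z - (a +i* b)) <= u2 - u1 + (v2 - v1).
    apply: le_trans (normc_le_ReIm _) _; rewrite RecD RecN ImcD ImcN /=.
    by apply: lerD; rewrite ler_norml; lra.
  have := Hd (z - (a +i* b)); rewrite [_ + (z - _)]addrC subrK => /(_ _)/le_trans h.
  have -> : G z + -1 * (A + D * z) = G z - G (a +i* b) - D * (z - (a +i* b)).
    by rewrite /A; ring.
  apply: h; first by apply: le_lt_trans zs _; lra.
  by rewrite ler_pM2l.
- by rewrite expr2 !mulrA.
Qed.

End goursat.

Section cauchy_formula.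
Context {R : realType}.
Implicit Types (G : cplx R -> cplx R) (x y : R) (z : cplx R).
Local Notation mu := (@lebesgue_measure R).

Lemma continuous_poisson xi e x : 0 < e ->
  {for x, continuous (fun x : R => e / ((x - xi) ^+ 2 + e ^+ 2))}.
Proof.
move=> e0; apply: cvgM; first exact: cvg_cst.
apply: cvgV; first by rewrite gt_eqF// ltr_wpDl ?sqr_ge0 ?exprn_gt0.
apply: cvgD; last exact: cvg_cst.
apply: (@continuous_comp _ _ _ (fun u : R => u - xi) (fun v : R => v ^+ 2)).
  by apply: cvgB; [exact: cvg_id|exact: cvg_cst].
exact: exprn_continuous.
Qed.

(** The antiderivative is [atan ((x - xi) / e)], which gives [2 * atan 1]. *)
Lemma Rintegral_poisson xi e : 0 < e ->
  Rintegral mu `[xi - e, xi + e] (fun x => e / ((x - xi) ^+ 2 + e ^+ 2)) = pi / 2.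
Proof.
move=> e0; pose F x : R := atan ((x - xi) / e).
have dA x : is_derive x (1 : R) (fun x : R => (x - xi) / e) (e^-1).
  have -> : (fun x : R => (x - xi) / e) = e^-1 \*: (id - cst xi).
    by apply/funext => u /=; rewrite mulrC.
  by apply: is_derive_eq; rewrite subr0 -[LHS]/(_ * _) mulr1.
have dF x : is_derive x (1 : R) F (e / ((x - xi) ^+ 2 + e ^+ 2)).
  have -> : e / ((x - xi) ^+ 2 + e ^+ 2) = (1 + ((x - xi) / e) ^+ 2)^-1 * e^-1.
    by field; apply/andP; split; rewrite gt_eqF// ltr_pwDl ?sqr_ge0 ?exprn_gt0.
  exact: (@is_derive1_comp _ atan (fun u : R => (u - xi) / e) x _ _ (is_derive1_atan ((x - xi) / e)) (dA x)).
have cF x : {for x, continuous F}.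
  by apply/differentiable_continuous/derivable1_diffP; exact: ex_derive.
rewrite /Rintegral (@continuous_FTC2 _ _ F)/=.
- rewrite /F !(addrC xi) addrK (_ : - e + xi - xi = - e); last by ring.
  by rewrite mulNr divff ?gt_eqF// atanN !atan1 opprK; field.
- lra.
- by apply: continuous_in_subspaceT => x _; exact: continuous_poisson.
- split.
  + by move=> x _; exact: ex_derive.
  + by apply: cvg_at_right_filter; exact: cF.
  + by apply: cvg_at_left_filter; exact: cF.
- by move=> x _; rewrite derive1E derive_val.
Qed.

Lemma derivable_inv_shift (zeta z : cplx R) : z != zeta ->
  derivable (fun u : cplx R => (u - zeta)^-1 : cplx R) z 1.
Proof.
move=> zz; apply: derivableV; first by rewrite subr_eq0.
by apply: derivableB; [exact: derivable_id|exact: derivable_cst].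
Qed.

(** Two vertical and two horizontal cuts leave the square around [zeta] and four rectangles free of
    [zeta], on which Goursat's theorem applies. *)
Lemma rect_int_shrink x1 x2 y1 y2 G (zeta : cplx R) e : 0 < e ->
  x1 <= Re zeta - e -> Re zeta + e <= x2 -> y1 <= Im zeta - e -> Im zeta + e <= y2 ->
  (forall z, in_rect x1 x2 y1 y2 z -> z != zeta -> derivable G z 1) ->
  rect_int x1 x2 y1 y2 G =
  rect_int (Re zeta - e) (Re zeta + e) (Im zeta - e) (Im zeta + e) G.
Proof.
move=> e0; set a := Re zeta - e; set b := Re zeta + e; set c := Im zeta - e; set d := Im zeta + e.
move=> xa bx yc dy dG.
have [ab cd] : a <= b /\ c <= d by rewrite /a /b /c /d; lra.
have aE : Re zeta = a + e by rewrite /a; lra.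
have bE : Re zeta = b - e by rewrite /b; lra.
have cE : Im zeta = c + e by rewrite /c; lra.
have dE : Im zeta = d - e by rewrite /d; lra.
have neq z : Re z <= a \/ b <= Re z \/ Im z <= c \/ d <= Im z -> z != zeta.
  by move=> H; apply/eqP => zE; move: H; rewrite zE; lra.
have dG' z : in_rect x1 x2 y1 y2 z ->
    Re z <= a \/ b <= Re z \/ Im z <= c \/ d <= Im z -> derivable G z 1.
  by move=> zr /neq; exact: dG.
clearbody a b c d.
have ch y u v : x1 <= u -> v <= x2 -> y1 <= y <= y2 -> y <= c \/ d <= y ->
    cintegrable `[u, v] (fun x => G (x +i* y)).
  move=> xu vx yy yH; apply: cintegrable_hline => x xx; apply: derivable_continuous.
  by apply: dG'; rewrite /in_rect /=; lra.
have cv x u v : y1 <= u -> v <= y2 -> x1 <= x <= x2 -> x <= a \/ b <= x ->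
    cintegrable `[u, v] (fun y => G (x +i* y)).
  move=> xu vx yy yH; apply: cintegrable_vline => y xx; apply: derivable_continuous.
  by apply: dG'; rewrite /in_rect /=; lra.
rewrite (@rect_int_split_re _ x1 a x2)//; [|lra|by apply: ch; lra|by apply: ch; lra].
rewrite (@rect_int_split_re _ a b x2)//; [|by apply: ch; lra|by apply: ch; lra].
rewrite (@rect_int_split_im _ a b y1 c y2)//; [|lra|by apply: cv; lra|by apply: cv; lra].
rewrite (@rect_int_split_im _ a b c d y2)//; [|by apply: cv; lra|by apply: cv; lra].
rewrite (@goursat _ x1 a)//; [|lra|by rewrite /in_rect => z zr; apply: dG'; rewrite /in_rect; lra].
rewrite (@goursat _ b x2)//; [|lra|by rewrite /in_rect => z zr; apply: dG'; rewrite /in_rect; lra].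
rewrite (@goursat _ a b y1 c)//; [|by rewrite /in_rect => z zr; apply: dG'; rewrite /in_rect; lra].
rewrite (@goursat _ a b d y2)//; [|by rewrite /in_rect => z zr; apply: dG'; rewrite /in_rect; lra].
by rewrite !add0r !addr0.
Qed.

(** On a square centred at [zeta] the integrands on opposite sides combine to twice the Poisson
    kernel, up to a factor ['i]; each pair of sides contributes ['i * pi]. *)
Lemma rect_int_inv (zeta : cplx R) e : 0 < e ->
  rect_int (Re zeta - e) (Re zeta + e) (Im zeta - e) (Im zeta + e)
    (fun z => (z - zeta)^-1) = 'i * (2 * pi)%:C.
Proof.
case: zeta => xi eta /= e0.
have e20 u : u ^+ 2 + e ^+ 2 != 0.
  by rewrite gt_eqF// ltr_wpDl ?sqr_ge0 ?exprn_gt0.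
have [||z zb|] := @cintegrable_sides R (xi - e) (xi + e) (eta - e) (eta + e) _ _
    (fun z => (z - xi +i* eta)^-1); [lra|lra| |move=> i1 i2 i3 i4].
  apply: derivable_continuous; apply: derivable_inv_shift; apply/eqP => zE.
  by move: zb; rewrite zE /on_rect /=; case=> _ []; lra.
rewrite /rect_int -!cRintB//.
have poisson c : cRint `[c - e, c + e] (fun x => 0 +i* (2 * (e / ((x - c) ^+ 2 + e ^+ 2)))) =
    'i * pi%:C.
  apply/eqP; rewrite eq_complex /= Rintegral_cst// RintegralZl//.
    by rewrite Rintegral_poisson//; apply/andP; split; apply/eqP; field.
  apply: continuous_compact_integrable; first exact: segment_compact.
  by apply: continuous_in_subspaceT => x _; exact: continuous_poisson.
rewrite (eq_cRint (g := fun x => 0 +i* (2 * (e / ((x - xi) ^+ 2 + e ^+ 2))))); last first.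
  move=> x _; apply/eqP; rewrite eq_complex /=.
  by apply/andP; split; apply/eqP; field; rewrite 1?(addrAC eta) ?subrr ?add0r ?sqrrN ?e20.
rewrite poisson.
rewrite (eq_cRint (D := `[eta - e, eta + e]%classic)
   (g := fun y => - 'i * (0 +i* (2 * (e / ((y - eta) ^+ 2 + e ^+ 2)))))); last first.
  move=> x _; apply/eqP; rewrite eq_complex /=.
  by apply/andP; split; apply/eqP; field; exact: e20.
rewrite cRintZ//; last first.
  apply: cintegrable_continuous => x _; apply: continuous_complex.
    exact: cst_continuous.
  by apply: cvgM; [exact: cvg_cst|exact: continuous_poisson].
rewrite poisson; apply/eqP; rewrite eq_complex /=.
by apply/andP; split; apply/eqP; ring.
Qed.

(** After shrinking to a square of half-side [e], [psi z] is compared with [psi zeta]. The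
    difference quotient at [zeta] stays below [nc D + 1], while the perimeter is [8 * e], so the
    error vanishes with [e]. *)
Lemma cauchy_formula x1 x2 y1 y2 (psi : cplx R -> cplx R) (zeta : cplx R) :
  x1 < Re zeta < x2 -> y1 < Im zeta < y2 ->
  (forall z, in_rect x1 x2 y1 y2 z -> derivable psi z 1) ->
  rect_int x1 x2 y1 y2 (fun z => psi z * (z - zeta)^-1) = 'i * (2 * pi)%:C * psi zeta.
Proof.
move=> /andP[x1z zx2] /andP[y1z zy2] dpsi.
have zr : in_rect x1 x2 y1 y2 zeta by rewrite /in_rect; lra.
have /derivable_normc[D /(_ _ ltr01)[d d0 Hd]] := dpsi _ zr.
(* On the square of half-side [e] one has [nc (z - zeta) <= 2 * e], which [d / 4] keeps below [d];
   the other terms keep the square inside the rectangle. *)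
pose e0 := Num.min (d / 4) (Num.min (Num.min (Re zeta - x1) (x2 - Re zeta))
                                    (Num.min (Im zeta - y1) (y2 - Im zeta))).
have e00 : 0 < e0 by rewrite !lt_min; lra.
suff H e : 0 < e <= e0 -> nc (rect_int x1 x2 y1 y2 (fun z => psi z * (z - zeta)^-1)
    - 'i * (2 * pi)%:C * psi zeta) <= 16 * (nc D + 1) * e.
  apply/eqP; rewrite -subr_eq0; apply/eqP/Normc.eq0_normc/eqP.
  rewrite eq_le normc_ge0 andbT; apply/ler_addgt0Pr => e e_0; rewrite add0r.
  have K0 : 0 < 16 * (nc D + 1) by have := normc_ge0 D; lra.
  apply: le_trans (H (Num.min e0 (e / (16 * (nc D + 1)))) _) _.
    by rewrite lt_min e00 divr_gt0// ge_min lexx.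
  by rewrite mulrC -ler_pdivlMr// ge_min lexx orbT.
move=> /andP[e_0]; rewrite !le_min => /andP[ed /andP[/andP[ex1 ex2] /andP[ey1 ey2]]].
rewrite (@rect_int_shrink _ _ _ _ _ zeta e)//; [|lra|lra|lra|lra|]; last first.
  move=> z zr' zz; apply: derivableM; first exact: dpsi.
  exact: derivable_inv_shift.
rewrite -(rect_int_inv zeta e_0).
set a := Re zeta - e; set b := Re zeta + e; set c := Im zeta - e; set f := Im zeta + e.
have [ab cf] : a <= b /\ c <= f by rewrite /a /b /c /f; lra.
have neq z : on_rect a b c f z -> z != zeta.
  by rewrite /on_rect /in_rect /a /b /c /f => zb; apply/eqP => zE; move: zb; rewrite zE => -[_ []]; lra.
have ci (k : cplx R) z : on_rect a b c f z -> {for z, continuous (fun z : cplx R => k * (z - zeta)^-1)}.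
  move=> /neq zz; apply: derivable_continuous; apply: derivableM; first exact: derivable_cst.
  exact: derivable_inv_shift.
have ci1 z : on_rect a b c f z -> {for z, continuous (fun z : cplx R => (z - zeta)^-1)}.
  by move=> /neq zz; apply: derivable_continuous; exact: derivable_inv_shift.
have cp z : on_rect a b c f z -> {for z, continuous (fun z : cplx R => psi z * (z - zeta)^-1)}.
  move=> zb; apply: derivable_continuous; apply: derivableM; last exact: derivable_inv_shift (neq _ zb).
  by apply: dpsi; move: zb; rewrite /on_rect /in_rect /a /b /c /f => -[]; lra.
have -> : rect_int a b c f (fun z => psi z * (z - zeta)^-1)
   - rect_int a b c f (fun z => (z - zeta)^-1) * psi zeta =
   rect_int a b c f (fun z => psi z * (z - zeta)^-1 + (- psi zeta) * (z - zeta)^-1).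
  apply/esym; apply: etrans (rect_intD ab cf cp (ci _)) _; congr (_ + _).
  by apply: etrans (rect_intZ ab cf _ ci1) _; rewrite mulrC mulrN.
apply: le_trans (@rect_int_bound _ _ _ _ _ ab cf _ (nc D + 1) _ _) _.
- by move=> z zb; apply: continuousD; [exact: cp|exact: ci].
- move=> z zb; rewrite -mulrDl Normc.normcM Normc.normcV ler_pdivrMr; last first.
    by apply: normc_gt0; rewrite subr_eq0 neq.
  have zd : nc (z - zeta) < d.
    apply: le_lt_trans (normc_le_ReIm _) _; rewrite RecD RecN ImcD ImcN.
    move: zb => [[]]; rewrite /a /b /c /f => h1 h2 _.
    have : `|Re z - Re zeta| <= e by rewrite ler_norml; lra.
    have : `|Im z - Im zeta| <= e by rewrite ler_norml; lra.
    lra.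
  have := Hd _ zd; rewrite (addrC zeta) subrK mul1r => h.
  have -> : psi z - psi zeta = (psi z - psi zeta - D * (z - zeta)) + D * (z - zeta) by ring.
  apply: le_trans (le_normcD _ _) _; rewrite Normc.normcM mulrDl mul1r addrC.
  by rewrite lerD2l.
- rewrite le_eqVlt; apply/orP; left; apply/eqP; rewrite /a /b /c /f; ring.
Qed.

End cauchy_formula.

(** * Taylor estimates with explicit constants *)

Section taylor.
Context {R : realType}.
Implicit Types (G : cplx R -> cplx R) (z t zeta : cplx R) (r M : R).

Lemma rect_int_lin x1 x2 y1 y2 (k : cplx R) G H : x1 <= x2 -> y1 <= y2 ->
  (forall z, on_rect x1 x2 y1 y2 z -> {for z, continuous G}) ->
  (forall z, on_rect x1 x2 y1 y2 z -> {for z, continuous H}) ->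
  rect_int x1 x2 y1 y2 (fun z => G z + k * H z) =
  rect_int x1 x2 y1 y2 G + k * rect_int x1 x2 y1 y2 H.
Proof.
move=> x12 y12 cG cH; apply: etrans (rect_intD x12 y12 cG _) _.
  by move=> z zr; apply: continuousM; [exact: cst_continuous|exact: cH].
by congr (_ + _); exact: rect_intZ.
Qed.

Definition in_square z0 r z :=
  in_rect (Re z0 - r) (Re z0 + r) (Im z0 - r) (Im z0 + r) z.

Lemma in_squareP z0 r t : nc t <= r -> in_square z0 r (z0 + t).
Proof.
move=> tr; have := normr_Re t; have := normr_Im t.
by rewrite /in_square /in_rect RecD ImcD => /le_trans/(_ tr)+ /le_trans/(_ tr); rewrite !ler_norml; lra.
Qed.

(** By Cauchy's formula at [z0 + t] and [z0], the remainder is the contour integral of [G z] times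
    [t^2 / ((z - z0 - t) (z - z0)^2)], where the denominators are bounded below by [r / 2] and [r].
    That the constants involve only [M] and [r] is the point: the estimate is then uniform over a
    family of functions and survives a functional. *)
Lemma taylor_square G z0 r M : 0 < r ->
  (forall z, in_square z0 r z -> derivable G z 1) ->
  (forall z, in_square z0 r z -> nc (G z) <= M) ->
  exists D : cplx R, nc D <= 16 * M / r /\ forall t, nc t <= r / 2 ->
    nc (G (z0 + t) - G z0 - t * D) <= 32 * M / r ^+ 2 * nc t ^+ 2.
Proof.
move=> r0 dG GM; have M0 : 0 <= M.
  by apply: le_trans (normc_ge0 _) (GM (z0 + 0) _); apply: in_squareP; rewrite (Normc.normc0 R) ltW.
set a := Re z0 - r in dG GM *; set b := Re z0 + r in dG GM *.
have [ab cd] : Re z0 - r <= Re z0 + r /\ Im z0 - r <= Im z0 + r by lra.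
(* As [2 pi] is at least 1, the factor [c^-1] of Cauchy's formula is simply dropped from all
   bounds. *)
pose c : cplx R := 'i * (2 * pi)%:C.
have ci : 1 <= nc c.
  have := @pi_ge2 R => pi2; rewrite /c Normc.normcM normc_real ger0_norm; last by lra.
  by rewrite normc_i; lra.
have c0 : c != 0 by apply/eqP => c0; move: ci; rewrite c0 (Normc.normc0 R); lra.
have cV (u : cplx R) : nc (c^-1 * u) <= nc u.
  rewrite Normc.normcM Normc.normcV ler_piMl ?normc_ge0// invf_le1//.
  exact: lt_le_trans ci.
pose J := rect_int (Re z0 - r) (Re z0 + r) (Im z0 - r) (Im z0 + r).
pose i0 z := (z - z0)^-1 : cplx R.
have bd z : on_rect (Re z0 - r) (Re z0 + r) (Im z0 - r) (Im z0 + r) z -> r <= nc (z - z0).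
  move=> [_]; have := normr_Re (z - z0); have := normr_Im (z - z0).
  rewrite RecD RecN ImcD ImcN => h1 h2 [] zE.
  - by apply: le_trans h2; rewrite zE addrAC subrr add0r normrN ler_norm.
  - by apply: le_trans h2; rewrite zE addrAC subrr add0r ler_norm.
  - by apply: le_trans h1; rewrite zE addrAC subrr add0r normrN ler_norm.
  - by apply: le_trans h1; rewrite zE addrAC subrr add0r ler_norm.
have bdt t z : nc t <= r / 2 ->
    on_rect (Re z0 - r) (Re z0 + r) (Im z0 - r) (Im z0 + r) z -> r / 2 <= nc (z - (z0 + t)).
  move=> tr /bd zr; rewrite opprD addrA; have := normc_lerB (z - z0) t; lra.
have dI t z : nc t <= r / 2 -> on_rect (Re z0 - r) (Re z0 + r) (Im z0 - r) (Im z0 + r) z ->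
    derivable (fun z : cplx R => (z - (z0 + t))^-1 : cplx R) z 1.
  move=> tr zr; apply: derivable_inv_shift; apply/eqP => zE.
  by have := bdt _ _ tr zr; rewrite zE subrr (Normc.normc0 R); lra.
have n0 : nc (0 : cplx R) <= r / 2 by rewrite (Normc.normc0 R); lra.
have dI0 z : on_rect (Re z0 - r) (Re z0 + r) (Im z0 - r) (Im z0 + r) z -> derivable i0 z 1.
  by move=> /(dI 0 _ n0); rewrite addr0.
have cauchy t : nc t <= r / 2 -> J (fun z => G z * (z - (z0 + t))^-1) = c * G (z0 + t).
  move=> tr; apply: cauchy_formula => //; have := normr_Re t; have := normr_Im t;
    by rewrite ?RecD ?ImcD => /le_trans/(_ tr)+ /le_trans/(_ tr); rewrite !ler_norml; lra.
have dG0 z : on_rect (Re z0 - r) (Re z0 + r) (Im z0 - r) (Im z0 + r) z ->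
    derivable (fun z : cplx R => G z * i0 z : cplx R) z 1.
  by move=> zr; apply: derivableM; [exact: dG zr.1|exact: dI0].
have dG00 z : on_rect (Re z0 - r) (Re z0 + r) (Im z0 - r) (Im z0 + r) z ->
    derivable (fun z : cplx R => G z * i0 z * i0 z : cplx R) z 1.
  by move=> zr; apply: derivableM; [exact: dG0|exact: dI0].
have ni0 z : on_rect (Re z0 - r) (Re z0 + r) (Im z0 - r) (Im z0 + r) z -> nc (i0 z) <= r^-1.
  move=> /bd zr; rewrite Normc.normcV lef_pV2// posrE//; exact: lt_le_trans zr.
pose D := c^-1 * J (fun z => G z * i0 z * i0 z).
exists D; split.
  apply: le_trans (cV _) _.
  apply: le_trans (@rect_int_bound _ _ _ _ _ ab cd _ (M * r^-1 * r^-1) _ _) _.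
  - by move=> z zr; apply: derivable_continuous; exact: dG00.
  - move=> z zr; rewrite !Normc.normcM !ler_pM ?mulr_ge0 ?normc_ge0 ?ni0//; exact: GM zr.1.
  - by rewrite le_eqVlt; apply/orP; left; apply/eqP; field; rewrite gt_eqF.
move=> t tr.
have dGt z : on_rect (Re z0 - r) (Re z0 + r) (Im z0 - r) (Im z0 + r) z ->
    derivable (fun z : cplx R => G z * (z - (z0 + t))^-1 : cplx R) z 1.
  by move=> zr; apply: derivableM; [exact: dG zr.1|exact: dI].
have c1 z zr := derivable_continuous (dGt z zr).
have c2 z zr := derivable_continuous (dG0 z zr).
have c3 z zr := derivable_continuous (dG00 z zr).
have c4 z : on_rect (Re z0 - r) (Re z0 + r) (Im z0 - r) (Im z0 + r) z ->
    {for z, continuous (fun z : cplx R => G z * (z - (z0 + t))^-1 + -1 * (G z * i0 z) : cplx R)}.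
  move=> zr; apply: continuousD; first exact: c1.
  by apply: continuousM; [exact: cst_continuous|exact: c2].
have c5 z : on_rect (Re z0 - r) (Re z0 + r) (Im z0 - r) (Im z0 + r) z ->
    {for z, continuous (fun z : cplx R => G z * (z - (z0 + t))^-1 + -1 * (G z * i0 z)
      + - t * (G z * i0 z * i0 z) : cplx R)}.
  move=> zr; apply: continuousD; first exact: c4.
  by apply: continuousM; [exact: cst_continuous|exact: c3].
have E : G (z0 + t) - G z0 - t * D = c^-1 *
    J (fun z => G z * (z - (z0 + t))^-1 + -1 * (G z * i0 z) + - t * (G z * i0 z * i0 z)).
  have -> : J (fun z => G z * (z - (z0 + t))^-1 + -1 * (G z * i0 z) + - t * (G z * i0 z * i0 z))
     = c * G (z0 + t) + -1 * (c * G z0) + - t * J (fun z => G z * i0 z * i0 z).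
    apply: etrans (rect_int_lin (- t) ab cd c4 c3) _; congr (_ + _).
    apply: etrans (rect_int_lin (-1) ab cd c1 c2) _; congr (_ + -1 * _); first exact: cauchy.
    by have := cauchy 0 n0; rewrite addr0.
  by rewrite /D; field.
rewrite E; apply: le_trans (cV _) _.
apply: le_trans (@rect_int_bound _ _ _ _ _ ab cd _ (M * nc t ^+ 2 * (2 / r * r^-1 * r^-1)) _ _) _.
- exact: c5.
- move=> z zr.
  have nz : z - z0 != 0.
    by apply/eqP => zE; have := bd _ zr; rewrite zE (Normc.normc0 R); lra.
  have nzt : z - (z0 + t) != 0.
    by apply/eqP => zE; have := bdt _ _ tr zr; rewrite zE (Normc.normc0 R); lra.
  have -> : G z * (z - (z0 + t))^-1 + -1 * (G z * i0 z) + - t * (G z * i0 z * i0 z) =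
     G z * (t * t) * ((z - (z0 + t))^-1 * i0 z * i0 z).
    by rewrite /i0; field; rewrite nz.
  rewrite !Normc.normcM -expr2 ler_pM ?mulr_ge0 ?sqr_ge0 ?normc_ge0//.
    by rewrite ler_wpM2r ?sqr_ge0//; exact: GM zr.1.
  rewrite !ler_pM ?mulr_ge0 ?normc_ge0 ?ni0//.
  rewrite Normc.normcV -[2 / r]invf_div lef_pV2 ?posrE ?bdt// ?divr_gt0//.
  by apply: lt_le_trans (bdt _ _ tr zr); rewrite divr_gt0.
- by rewrite le_eqVlt; apply/orP; left; apply/eqP; field; rewrite gt_eqF.
Qed.

End taylor.

(** * The Hahn-Banach theorem *)

Section hahn_banach.
Context {R : realType} {V : lmodType R[i]}.
(* [N v a] stands for [p v <= a], where the seminorm [p] may take the value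
   [+oo]; this is why the extension is defined on the whole space. *)
Variables (N : V -> R -> Prop).
Hypotheses (N0 : N 0 0)
  (ND : forall u v a b, N u a -> N v b -> N (u + v) (a + b))
  (NZ : forall (k : R[i]) u a, N u a -> N (k *: u) (nc k * a)).
Implicit Types (G : set (V * R)) (u v : V) (r s a k : R).

Let NZr k u a : N u a -> N (k%:C *: u) (`|k| * a).
Proof. by move=> /(NZ k%:C); rewrite normc_real. Qed.

Let scaleN1C u : (-1)%:C *: u = - u.
Proof. by rewrite rmorphN rmorph1 scaleN1r. Qed.

(* Domination and [N 0 0] make such a relation single-valued. *)
Let real_graph G :=
  (forall u r v s k, G (u, r) -> G (v, s) -> G (u + k%:C *: v, r + k * s)) /\
  (forall v r a, G (v, r) -> N v a -> r <= a).

Let real_graphN G v r : real_graph G -> G (0, 0) -> G (v, r) -> G (- v, - r).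
Proof.
by move=> [Gl _] G0 Gv; have := Gl _ _ _ _ (-1) G0 Gv; rewrite !add0r mulN1r scaleN1C.
Qed.

(** The value [c] at [v] has to lie above all [r - a] with [N (u - v) a] and below all [a' - r']
    with [N (u' + v) a']. Adding the two bounds eliminates [v] and shows that the former never
    exceed the latter. Other multiples of [v] reduce to [v] and [- v] by scaling. [v] may already
    lie in the domain: domination then forces [c] to be its old value. *)
Lemma real_graph_extend G v : real_graph G -> G (0, 0) ->
  exists G', [/\ real_graph G', G `<=` G' & exists r, G' (v, r)].
Proof.
move=> rG G0; have [Gl Gd] := rG.
pose L := [set c | exists u r a, [/\ G (u, r), N (u - v) a & c = r - a]].
have [c Hc] : exists c, forall u r a, G (u, r) ->
    (N (u + v) a -> r + c <= a) /\ (N (u - v) a -> r - c <= a).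
  have UL u r a u' r' a' : G (u, r) -> N (u - v) a -> G (u', r') -> N (u' + v) a' ->
      r - a <= a' - r'.
    move=> Gu Nu Gu' Nu'; have := ND Nu Nu'; rewrite addrACA addNr addr0 => Nuu.
    have := Gl _ _ _ _ 1 Gu Gu'; rewrite scale1r mul1r => /Gd/(_ Nuu).
    by lra.
  have Lub u r a : G (u, r) -> N (u + v) a -> ubound L (a - r).
    by move=> Gu Nu _ [u' [r' [a' [Gu' Nu' ->]]]]; exact: UL Gu' Nu' Gu Nu.
  (* If [L] is empty, [sup L] is a default value, but then nothing is asked of it: either premise on
     [N] produces an element of [L]. *)
  exists (sup L) => u r a Gu; split=> Nu.
  - rewrite addrC -lerBrDr; apply: ge_sup; last exact: Lub Gu Nu.
    exists (- r - a), (- u), (- r), a; split => //; first exact: real_graphN.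
    by have := NZr (-1) Nu; rewrite normrN1 mul1r scaleN1C opprD.
  - rewrite lerBlDr -lerBlDl; apply: ub_le_sup; last by exists u, r, a.
    exists (a - - r); apply: (@Lub (- u)); first exact: real_graphN.
    by have := NZr (-1) Nu; rewrite normrN1 mul1r scaleN1C opprB addrC.
exists [set x | exists u r k, G (u, r) /\ x = (u + k%:C *: v, r + k * c)].
split; [split| |].
- move=> _ _ _ _ k [u1 [r1 [k1 [Gu1 [-> ->]]]]] [u2 [r2 [k2 [Gu2 [-> ->]]]]].
  exists (u1 + k%:C *: u2), (r1 + k * r2), (k1 + k * k2); split; first exact: Gl.
  congr (_, _); last by ring.
  by rewrite scalerDr scalerA addrACA -scalerDl -rmorphM -rmorphD.
- move=> _ _ a [u [r [k [Gu [-> ->]]]]] Nu.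
  have [k0|k0|k0] := ltgtP k 0.
  + have m0 : 0 < - k by lra.
    have Gm := Gl _ _ _ _ (- k)^-1 G0 Gu; rewrite !add0r in Gm.
    have := NZr (- k)^-1 Nu.
    have kk : (- k)^-1 * k = -1 by field; rewrite lt_eqF.
    rewrite scalerDr scalerA -rmorphM kk scaleN1C.
    move=> /(proj2 (Hc _ _ _ Gm)).
    rewrite gtr0_norm ?invr_gt0// -(ler_pM2l m0) mulrBr !mulrA divff ?gt_eqF// !mul1r.
    by rewrite mulNr opprK.
  + have Gm := Gl _ _ _ _ k^-1 G0 Gu; rewrite !add0r in Gm.
    have := NZr k^-1 Nu.
    rewrite scalerDr scalerA -rmorphM mulVf ?gt_eqF// scale1r.
    move=> /(proj1 (Hc _ _ _ Gm)).
    by rewrite gtr0_norm ?invr_gt0// -(ler_pM2l k0) mulrDr !mulrA divff ?gt_eqF// !mul1r.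
  + by rewrite k0 mul0r addr0; apply: Gd Gu _; move: Nu; rewrite k0 scale0r addr0.
- by move=> [u r] Gu; exists u, r, 0; split => //; rewrite scale0r mul0r !addr0.
- by exists c, 0, 0, 1; split => //; rewrite scale1r mul1r !add0r.
Qed.

Lemma hahn_banach_real (G0 : set (V * R)) : real_graph G0 -> G0 (0, 0) ->
  exists g : V -> R, [/\ forall u v k, g (u + k%:C *: v) = g u + k * g v,
    forall v r, G0 (v, r) -> g v = r & forall v a, N v a -> g v <= a].
Proof.
move=> rG0 G00.
pose P := [set G | G = set0 \/ (real_graph G /\ G0 `<=` G)].
have [F FP Ftot|A [PA Amax]] := @Zorn_bigcup _ P.
  have [[X [FX X0]]|H] := pselect (exists X, F X /\ X <> set0); last first.
    left; apply/seteqP; split => // x [X FX Xx]; apply: H; exists X; split => // X0.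
    by move: Xx; rewrite X0.
  right; split; last first.
    by move=> x G0x; exists X => //; have [//|[_]] := FP _ FX; apply.
  split.
    move=> u r v s k [X1 F1 Xu] [X2 F2 Xv].
    have [Y [FY Yu Yv]] : exists Y, [/\ F Y, Y (u, r) & Y (v, s)].
      have [X12|X21] := Ftot _ _ F1 F2.
        by exists X2; split; [exact: F2|exact: X12 Xu|exact: Xv].
      by exists X1; split; [exact: F1|exact: Xu|exact: X21 Xv].
    exists Y => //; have [Y0|[[Yl _] _]] := FP _ FY; first by move: Yu; rewrite Y0.
    exact: Yl.
  move=> v r a [Y FY Yv]; have [Y0|[[_ Yd] _]] := FP _ FY; first by move: Yv; rewrite Y0.
  exact: Yd.
have [rA G0A] : real_graph A /\ G0 `<=` A.
  have [A0|//] := PA; exfalso; apply: (Amax G0); last by right; split.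
  by rewrite A0; split => // /(_ _ G00).
have A00 : A (0, 0) by exact: G0A.
have tot v : exists r, A (v, r).
  have [A' [rA' AA' [r A'v]]] := real_graph_extend v rA A00.
  exists r; apply: contrapT => nA; apply: (Amax A').
    by split => // /(_ _ A'v).
  by right; split => //; exact: subset_trans AA'.
have fct v r s : A (v, r) -> A (v, s) -> r = s.
  suff H r' s' : A (v, r') -> A (v, s') -> r' <= s'.
    by move=> Ar As; apply/eqP; rewrite eq_le !H.
  move=> Ar As; have [Al Ad] := rA; have := Al _ _ _ _ (-1) Ar As.
  by rewrite scaleN1C subrr mulN1r => /Ad/(_ N0); rewrite subr_le0.
have [g Hg] := choice tot; exists g; have [Al Ad] := rA; split.
- by move=> u v k; apply: fct (Hg _) _; exact: Al.
- by move=> v r /G0A; exact: fct.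
- by move=> v a; exact: Ad.
Qed.

(** A complex linear functional is recovered from its real part [h] as [h v - i h(i v)], so the real
    part of [f] is extended. The two terms are bounded separately, which costs the factor 2. *)
Lemma hahn_banach (W : set V) (f : V -> R[i]) : W 0 ->
  (forall u v (k : R[i]), W u -> W v -> W (u + k *: v)) ->
  (forall u v (k : R[i]), W u -> W v -> f (u + k *: v) = f u + k * f v) ->
  (forall u a, W u -> N u a -> nc (f u) <= a) ->
  exists g : V -> R[i], [/\ forall u v (k : R[i]), g (u + k *: v) = g u + k * g v,
    forall u, W u -> g u = f u & forall v a, N v a -> nc (g v) <= 2 * a].
Proof.
move=> W0 Wl fl fd.
have f0 : f 0 = 0 by have := fl 0 0 (-1) W0 W0; rewrite scaler0 addr0 mulN1r subrr.
have [||h [hl hf hd]] := @hahn_banach_real [set x | W x.1 /\ Re (f x.1) = x.2].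
- split=> [u r v s k /= [Wu <-] [Wv <-]|v r a /= [Wv <-] Nv].
    split; first exact: Wl.
    by rewrite fl//; case: (f u) (f v) => ? ? [? ?]; rewrite RecD RecM /= mul0r subr0.
  by apply: le_trans (fd _ _ Wv Nv); apply: le_trans (normr_Re _); exact: ler_norm.
- by rewrite /= f0.
have hD u v : h (u + v) = h u + h v by have := hl u v 1; rewrite scale1r mul1r.
have h0 : h 0 = 0 by apply: (@addrI _ (h 0)); rewrite -hD !addr0.
have hZ u k : h (k%:C *: u) = k * h u by have := hl 0 u k; rewrite !add0r h0 add0r.
have hN u : h (- u) = - h u by have := hZ u (-1); rewrite scaleN1C mulN1r.
pose g v : R[i] := h v -i* h ('i *: v).
have gD u v : g (u + v) = g u + g v.
  by apply/eqP; rewrite eq_complex /= scalerDr !hD opprD !eqxx.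
exists g; split.
- move=> u v k; rewrite gD; congr (_ + _); rewrite /g.
  have -> : 'i *: (k *: v) = k *: ('i *: v) by rewrite !scalerA mulrC.
  have hC (z : V) (x y : R) : h ((x%:C + 'i * y%:C) *: z) = x * h z + y * h ('i *: z).
    by rewrite scalerDl hD hZ (mulrC 'i) -scalerA hZ.
  rewrite [k]complexE !hC scalerA -expr2 sqr_i scaleN1r hN; apply/eqP.
  by case: k => x y; rewrite eq_complex /=; apply/andP; split; apply/eqP; ring.
- move=> u Wu; have Wi : W ('i *: u) by rewrite -[_ *: u]add0r; exact: Wl.
  rewrite /g (hf _ (Re (f u)))// (hf _ (Re (f ('i *: u))))//.
  rewrite -[_ *: u]add0r fl// f0 add0r; case: (f u) => x y; apply/eqP.
  by rewrite eq_complex /=; apply/andP; split; apply/eqP; ring.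
- move=> v a Nv; apply: le_trans (normc_le_ReIm _) _; rewrite mulr2n mulrDl !mul1r /=.
  have nle u b : N u b -> `|h u| <= b.
    move=> Nu; rewrite ler_norml hd// andbT lerNl -hN; apply: hd.
    by have := NZr (-1) Nu; rewrite normrN1 mul1r scaleN1C.
  rewrite normrN lerD ?nle//; have := NZ 'i Nv.
  by rewrite normc_i mul1r.
Qed.

End hahn_banach.

(** * Functionals dominated by a weighted supremum *)

Section weighted_functional.
Context {R : realType}.
Variables (T : set (cplx R)) (wt : cplx R -> R) (L : (cplx R -> cplx R) -> cplx R) (C : R).
Hypotheses (wt0 : forall z, 0 < wt z) (C0 : 0 <= C)
  (Llin : forall u v (k : cplx R), L (fun z => u z + k * v z) = L u + k * L v)
  (Lbd : forall v M, (forall z, T z -> nc (v z) * wt z <= M) -> nc (L v) <= C * M).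

Lemma functional0 : L (fun=> 0) = 0.
Proof.
have := Llin (fun=> 0) (fun=> 0) (-1).
rewrite (_ : (fun=> _) = (fun=> 0)) => [->|]; first by rewrite mulN1r subrr.
by apply/funext => z; rewrite mulr0 addr0.
Qed.

Lemma functionalZ v (k : cplx R) : L (fun z => k * v z) = k * L v.
Proof.
rewrite -[RHS]add0r -functional0 -Llin; congr L.
by apply/funext => z; rewrite add0r.
Qed.

Lemma functionalB u v : L (fun z => u z - v z) = L u - L v.
Proof.
rewrite -mulN1r -Llin; congr L.
by apply/funext => z; rewrite mulN1r.
Qed.

(** The bound with [M = 0]: [L] only sees values on [T]. *)
Lemma functional_eq u v : (forall z, T z -> u z = v z) -> L u = L v.
Proof.
move=> uv; apply/eqP; rewrite -subr_eq0 -functionalB; apply/eqP/Normc.eq0_normc/eqP.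
rewrite eq_le normc_ge0 andbT -[leRHS](mulr0 C); apply: Lbd => z Tz.
by rewrite uv// subrr (Normc.normc0 R) mul0r.
Qed.

(** The Taylor coefficients are chosen for each [zeta] separately. The resulting function [D] is an
    admissible argument of [L] whatever its regularity, and [L D] is the derivative because the
    remainders are small uniformly in [zeta]. *)
Lemma functional_taylor (Q : cplx R -> cplx R -> cplx R) z0 r M : 0 < r -> 0 <= M ->
  (forall zeta, T zeta -> forall z, in_square z0 r z ->
     derivable (Q^~ zeta) z 1 /\ nc (Q z zeta) * wt zeta <= M) ->
  exists D : cplx R, nc D <= C * (16 * M / r) /\ forall t, nc t <= r / 2 ->
    nc (L (Q (z0 + t)) - L (Q z0) - t * D) <= C * (32 * M / r ^+ 2 * nc t ^+ 2).
Proof.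
move=> r0 M0 HQ.
have HD zeta : exists d, T zeta -> nc d * wt zeta <= 16 * M / r /\ forall t, nc t <= r / 2 ->
    nc (Q (z0 + t) zeta - Q z0 zeta - t * d) * wt zeta <= 32 * M / r ^+ 2 * nc t ^+ 2.
  have [Tz|nT] := pselect (T zeta); last by exists 0 => /nT.
  have [|z zs|d [d1 d2]] := @taylor_square R (Q^~ zeta) z0 r (M / wt zeta) r0.
  - by move=> z /(HQ _ Tz)[].
  - by rewrite ler_pdivlMr//; have [] := HQ _ Tz _ zs.
  exists d => _; split.
    apply: le_trans (ler_wpM2r (ltW (wt0 zeta)) d1) _.
    by rewrite le_eqVlt; apply/orP; left; apply/eqP; field; rewrite !gt_eqF.
  move=> t /d2 h; apply: le_trans (ler_wpM2r (ltW (wt0 zeta)) h) _.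
  by rewrite le_eqVlt; apply/orP; left; apply/eqP; field; rewrite !gt_eqF.
have [D {}HD] := choice HD.
exists (L D); split; first by apply: Lbd => zeta /HD[].
move=> t tr; rewrite -functionalB.
have -> : L (fun z => Q (z0 + t) z - Q z0 z) - t * L D =
    L (fun z => Q (z0 + t) z - Q z0 z - t * D z).
  rewrite -mulNr -Llin; congr L; apply/funext => z; by rewrite mulNr.
by apply: Lbd => zeta /HD[_]; apply.
Qed.

Lemma functional_derivable (Q : cplx R -> cplx R -> cplx R) z0 r M : 0 < r -> 0 <= M ->
  (forall zeta, T zeta -> forall z, in_square z0 r z ->
     derivable (Q^~ zeta) z 1 /\ nc (Q z zeta) * wt zeta <= M) ->
  derivable (fun z => L (Q z)) z0 1.
Proof.
move=> r0 M0 HQ; have [D [_ HD]] := functional_taylor r0 M0 HQ.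
apply: (normc_derivable (D := D)) => e e0.
pose K := C * (32 * M / r ^+ 2).
have K0 : 0 <= K by rewrite /K !mulr_ge0// invr_ge0 sqr_ge0.
have K1 : 0 < K + 1 by lra.
exists (Num.min (r / 2) (e / (K + 1))); first by rewrite lt_min !divr_gt0.
move=> t; rewrite lt_min => /andP[/ltW/HD tr te]; rewrite (mulrC D).
apply: le_trans tr _; have t0 := normc_ge0 t.
rewrite (_ : C * _ = K * nc t * nc t); last by rewrite /K; ring.
apply: ler_wpM2r => //; move: te; rewrite ltr_pdivlMr// => te.
by rewrite mulrC; lra.
Qed.

Lemma functional_lipschitz (Q : cplx R -> cplx R -> cplx R) z0 r M t : 0 < r -> 0 <= M ->
  (forall zeta, T zeta -> forall z, in_square z0 r z ->
     derivable (Q^~ zeta) z 1 /\ nc (Q z zeta) * wt zeta <= M) ->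
  nc t <= r / 2 ->
  forall zeta, T zeta -> nc (Q (z0 + t) zeta - Q z0 zeta) * wt zeta <= 32 * M / r * nc t.
Proof.
move=> r0 M0 HQ tr zeta Tz.
have [|z zs|d [d1 /(_ _ tr) d2]] := @taylor_square R (Q^~ zeta) z0 r (M / wt zeta) r0.
- by move=> z /(HQ _ Tz)[].
- by rewrite ler_pdivlMr//; have [] := HQ _ Tz _ zs.
rewrite -ler_pdivlMr//.
have -> : Q (z0 + t) zeta - Q z0 zeta = (Q (z0 + t) zeta - Q z0 zeta - t * d) + t * d by ring.
apply: le_trans (le_normcD _ _) _; rewrite Normc.normcM.
apply: le_trans (lerD d2 (ler_wpM2l (normc_ge0 t) d1)) _.
have W0 := wt0 zeta; have t0 := normc_ge0 t.
(* For [nc t <= r / 2] the quadratic term contributes at most as much as the linear one,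
   [16 + 16 = 32]. *)
have -> : 32 * (M / wt zeta) / r ^+ 2 * nc t ^+ 2 + nc t * (16 * (M / wt zeta) / r) =
   (M / wt zeta / r ^+ 2 * nc t) * (32 * nc t + 16 * r).
  by field; rewrite !gt_eqF.
have -> : 32 * M / r * nc t / wt zeta = (M / wt zeta / r ^+ 2 * nc t) * (32 * r).
  by field; rewrite !gt_eqF.
apply: ler_wpM2l; last lra.
by rewrite !mulr_ge0 ?invr_ge0 ?sqr_ge0// ltW.
Qed.

Lemma functional_integral (g : R -> cplx R -> cplx R) a b K : a <= b -> 0 <= K ->
  (forall zeta, T zeta -> forall x, a <= x <= b -> {for x, continuous (g^~ zeta)}) ->
  (forall x, a <= x <= b -> {for x, continuous (fun x => L (g x))}) ->
  (forall zeta, T zeta -> forall x y, a <= x <= b -> a <= y <= b ->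
     nc (g x zeta - g y zeta) * wt zeta <= K * `|x - y|) ->
  L (fun zeta => cRint `[a, b] (g^~ zeta)) = cRint `[a, b] (fun x => L (g x)).
Proof.
move=> ab K0 cg cLg lip.
(* The defect is additive in the interval and at most quadratic in its length,
   hence zero: halving the interval [n] times gains a factor [2 ^ n]. *)
pose defect u v := L (fun zeta => cRint `[u, v] (g^~ zeta)) - cRint `[u, v] (fun x => L (g x)).
suff H n u v : a <= u -> u <= v -> v <= b ->
    nc (defect u v) <= 4 * C * K * (v - u) ^+ 2 / 2 ^+ n.
  apply/eqP; rewrite -subr_eq0; apply/eqP/Normc.eq0_normc/eqP.
  rewrite eq_le normc_ge0 andbT; apply/ler_addgt0Pr => e e0; rewrite add0r.
  have [n Hn] : exists n, 4 * C * K * (b - a) ^+ 2 / e < n%:R.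
    by exists (Num.trunc (4 * C * K * (b - a) ^+ 2 / e)).+1; rewrite truncnS_gt.
  apply: le_trans (H n _ _ _ _ _) _ => //.
  rewrite ler_pdivrMr ?exprn_gt0//.
  move: Hn; rewrite ltr_pdivrMr// => /ltW/le_trans; apply.
  by rewrite mulrC ler_pM2l// -natrX ler_nat ltnW// ltn_expl.
elim: n u v => [|n IH] u v au uv vb.
  have cgi zeta : T zeta -> cintegrable `[u, v] (g^~ zeta).
    by move=> Tz; apply: cintegrable_continuous => x xuv; apply: cg => //; lra.
  have cLi : cintegrable `[u, v] (fun x => L (g x)).
    by apply: cintegrable_continuous => x xuv; apply: cLg => //; lra.
  have cst k : cintegrable `[u, v] (fun=> k : cplx R).
    by apply: cintegrable_continuous => x xuv; exact: cst_continuous.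
  (* Both integrals are compared with the one of the constant integrand [g u]; each comparison costs
     [2 * C * K * (v - u) ^+ 2]. *)
  have -> : defect u v = (L (fun zeta => cRint `[u, v] (g^~ zeta)) - (v - u)%:C * L (g u))
     - (cRint `[u, v] (fun x => L (g x)) - (v - u)%:C * L (g u)).
    by rewrite /defect; ring.
  rewrite expr0 divr1; apply: le_trans (le_normcD _ _) _; rewrite normcN.
  have lipL x : u <= x <= v -> nc (L (g x) - L (g u)) <= C * (K * (v - u)).
    move=> xuv; rewrite -functionalB; apply: Lbd => zeta Tz.
    apply: le_trans (lip _ Tz _ _ _ _) _; [lra|lra|].
    by rewrite ler_wpM2l// ger0_norm; lra.
  have -> : 4 * C * K * (v - u) ^+ 2 =
    C * (2 * (K * (v - u)) * (v - u)) + 2 * (C * (K * (v - u))) * (v - u) by ring.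
  apply: lerD.
    rewrite -functionalZ -functionalB; apply: Lbd => zeta Tz.
    rewrite -(cRint_cst (g u zeta) uv) -cRintB//; last exact: cgi.
    rewrite -ler_pdivlMr//.
    apply: le_trans (@normc_cRint_itv _ _ _ _ (K * (v - u) / wt zeta) uv _ _) _.
    - by apply: cintegrableB => //; exact: cgi.
    - move=> x xuv; rewrite ler_pdivlMr//.
      apply: le_trans (lip _ Tz _ _ _ _) _; [lra|lra|].
      by rewrite ler_wpM2l// ger0_norm; lra.
    - by rewrite le_eqVlt; apply/orP; left; apply/eqP; field; rewrite gt_eqF.
  rewrite -(cRint_cst (L (g u)) uv) -cRintB//.
  by apply: normc_cRint_itv => //; exact: cintegrableB.
pose m := (u + v) / 2.
have [um mv] : u <= m /\ m <= v by rewrite /m; lra.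
have -> : defect u v = defect u m + defect m v.
  rewrite /defect (cRint_split um mv); last first.
    by apply: cintegrable_continuous => x xuv; apply: cLg => //; lra.
  rewrite opprD addrACA; congr (_ + _).
  rewrite -[L (fun zeta => cRint `[m, v] _)]mul1r -Llin; apply: functional_eq => zeta Tz.
  rewrite mul1r; apply: cRint_split => //.
  by apply: cintegrable_continuous => x xuv; apply: cg => //; lra.
apply: le_trans (le_normcD _ _) _.
have h1 := IH u m au um (le_trans mv vb).
have h2 := IH m v (le_trans au um) mv vb.
apply: le_trans (lerD h1 h2) _.
rewrite le_eqVlt; apply/orP; left; apply/eqP; rewrite /m (exprS 2 n); field.
by rewrite expf_neq0.
Qed.

End weighted_functional.

(** * Weights and test functions *)

Section weights.
Context {R : realType}.
Variable w : R -> R.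
Hypothesis weight_w : weight_function w.
Implicit Types (x y l : R).

Lemma wext_ge0 x : 0 <= wext w x.
Proof. by have [w0 _ _] := weight_w; apply: w0. Qed.

Lemma wext_le x y : `|x| <= `|y| -> wext w x <= wext w y.
Proof. by have [_ wle _] := weight_w; apply: wle. Qed.

(* [|l x| <= max |2 l y| |2 l (x - y)|]. *)
Lemma wext_split l x y : wext w (l * x) <= wext w (2 * l * y) + wext w (2 * l * (x - y)).
Proof.
have [h|h] := leP `|l * x| `|2 * l * y|.
  by apply: le_trans (wext_le h) _; rewrite lerDl wext_ge0.
apply: le_trans (@wext_le _ (2 * l * (x - y)) _) _; last by rewrite lerDr wext_ge0.
have -> : 2 * l * (x - y) = 2 * (l * x) - 2 * l * y by ring.
have e : `|2 * (l * x)| = 2 * `|l * x| by rewrite normrM ger0_norm.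
by apply: le_trans (lerB_dist _ _); rewrite e; lra.
Qed.

Lemma expR_wext_split l x y :
  expR (wext w (l * x)) <= expR (wext w (2 * l * y)) * expR (wext w (2 * l * (x - y))).
Proof. by rewrite -expRD ler_expR wext_split. Qed.

(** Since [w t / ln t] tends to infinity, [w t >= 2 * ln t] eventually, that is [e^{- w t} <= t^-2].
    [K1] serves the range [|l x| <= t1], [K2] its complement. *)
Lemma expR_wext_inv_sqr l : 0 < l -> exists2 K, 0 <= K &
  forall x, expR (- wext w (l * x)) <= K * (1 + x ^+ 2)^-1.
Proof.
move=> l0; have [_ _ /cvgryPge/(_ 2)] := weight_w.
(* Beyond [t1] the asymptotic bound holds and the logarithm is positive. *)
move=> [t0 [_ Ht]]; pose t1 := Num.max t0 1 + 1.
have t12 : 2 <= t1 by have := le_max 1 t0 1; rewrite lexx orbT /t1; lra.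
have t10 : t0 < t1 by have := le_max t0 t0 1; rewrite lexx /t1; lra.
pose K1 := 1 + t1 ^+ 2 / l ^+ 2; pose K2 := 1 + l ^- 2.
have K10 : 0 <= K1 by rewrite addr_ge0// divr_ge0 ?sqr_ge0.
have K20 : 0 <= K2 by rewrite addr_ge0// invr_ge0 sqr_ge0.
exists (K1 + K2); first exact: addr_ge0.
move=> x; have x1 : 0 < 1 + x ^+ 2 by rewrite ltr_pwDl ?sqr_ge0.
rewrite ler_pdivlMr//.
have [h|h] := leP `|l * x| t1.
  apply: (@le_trans _ _ (1 * K1)); last by rewrite mul1r lerDl.
  apply: ler_pM; rewrite ?expR_ge0 ?(ltW x1)//.
    by rewrite -expR0 ler_expR oppr_le0 wext_ge0.
  rewrite lerD2l ler_pdivlMr ?exprn_gt0// mulrC -exprMn.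
  by rewrite -(real_normK (num_real (l * x))) ler_sqr// ?nnegrE//; lra.
have lx1 : 1 < `|l * x| by lra.
have ln0 : 0 < ln `|l * x| by rewrite ln_gt0.
have := Ht `|l * x| (lt_trans t10 h); rewrite ler_pdivlMr// -/(wext w (l * x)) => hw.
have hx : expR (- wext w (l * x)) <= (`|l * x| ^+ 2)^-1.
  apply: (@le_trans _ _ (expR (- (2 * ln `|l * x|)))); first by rewrite ler_expR lerN2.
  by rewrite expRN mulr_natl -lnXn; [rewrite lnK// posrE exprn_gt0//; lra|lra].
apply: le_trans (ler_wpM2r (ltW x1) hx) _.
rewrite real_normK ?num_real// ler_pdivrMl; last first.
  by rewrite -(real_normK (num_real (l * x))) exprn_gt0//; lra.
have lx2 : 1 <= (l * x) ^+ 2.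
  by rewrite -(real_normK (num_real (l * x))) exprn_ege1// ltW.
have -> : x ^+ 2 = (l * x) ^+ 2 * l ^- 2 by field; rewrite gt_eqF.
have : 0 <= (l * x) ^+ 2 * K1 by rewrite mulr_ge0// sqr_ge0.
have : 0 <= l ^- 2 by rewrite invr_ge0 sqr_ge0.
rewrite /K2; nra.
Qed.

(** Write [w = 2 w - w]: by [cond_delta] the first term is at most a dilated weight plus [ln A], and
    the second gives quadratic decay. A dilation by [H] is thus traded for an integrable factor. *)
Lemma weight_decay l : cond_delta w -> 0 < l -> exists l' K, [/\ 0 < l', 0 <= K &
  forall x, expR (wext w (l * x)) <= K * (1 + x ^+ 2)^-1 * expR (wext w (l' * x))].
Proof.
move=> [A [H [A1 H1 HAH]]] l0.
have [K K0 HK] := expR_wext_inv_sqr l0.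
exists (H * l), (A * K); split; [by rewrite mulr_gt0//; lra|by rewrite mulr_ge0//; lra|].
move=> x; have := HAH `|l * x| (normr_ge0 _).
have -> : H * `|l * x| = `|H * l * x| by rewrite -mulrA [RHS]normrM ger0_norm//; lra.
rewrite -/(wext w (l * x)) -/(wext w (H * l * x)) => h.
have -> : wext w (l * x) = 2 * wext w (l * x) - wext w (l * x) by ring.
rewrite expRD; apply: le_trans (ler_wpM2r (expR_ge0 _) (_ : _ <= A * expR (wext w (H * l * x)))) _.
  have {1}-> : A = expR (ln A) by rewrite lnK// posrE; lra.
  by rewrite -expRD ler_expR addrC.
have e0 : 0 <= A * expR (wext w (H * l * x)) by rewrite mulr_ge0 ?expR_ge0//; lra.
apply: le_trans (ler_wpM2l e0 (HK x)) _.
by rewrite le_eqVlt; apply/orP; left; apply/eqP; ring.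
Qed.

(** A relation in place of [test_norm], because it is also applied to functions with unbounded
    weighted values, for which a supremum in [R] is a default value. *)
Definition wbounded (h l : R) (phi : cplx R -> cplx R) (M : R) :=
  forall z, strip h z -> nc (phi z) * expR (wext w (l * Re z)) <= M.

Lemma strip0 (h : R) : 0 < h -> strip h (0 : cplx R).
Proof. by move=> h0; rewrite /strip /= normr0. Qed.

Lemma wbounded_mono h h' l l' phi M : h <= h' -> 0 <= l -> l <= l' ->
  wbounded h' l' phi M -> wbounded h l phi M.
Proof.
move=> hh l0 ll H z zh; apply: le_trans (H z (lt_le_trans zh hh)).
rewrite ler_wpM2l ?normc_ge0// ler_expR wext_le// !normrM ler_wpM2r//.
by rewrite !ger0_norm//; exact: le_trans ll.
Qed.

Lemma test_norm_wbounded (h l : R) (phi : testfun w) : 0 < h -> 0 < l ->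
  wbounded h l phi (test_norm w h l phi).
Proof.
move=> h0 l0 z zh; apply: ub_le_sup; last by exists z.
by have /asboolP[_ H] := testfunP phi; exact: H.
Qed.

Lemma test_norm_le (h l : R) (phi : cplx R -> cplx R) M : 0 < h ->
  wbounded h l phi M -> test_norm w h l phi <= M.
Proof.
move=> h0 H; apply: ge_sup; last by move=> _ [z zh <-]; exact: H.
by eexists; exists 0; first exact: strip0.
Qed.

(** The norms increase with [h] and [l], so finitely many of them are dominated by one. The subbasic
    balls need not be centred at 0; what counts is the room that each leaves around 0. *)
Lemma test_subbase_nbhs0 (s : seq (set (testfun w))) :
  (forall B, B \in s -> test_subbase B /\ B 0) ->
  exists h l e : R, [/\ 0 < h, 0 < l, 0 < e &
    forall psi : testfun w, wbounded h l psi e -> forall B, B \in s -> B psi].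
Proof.
elim: s => [|B s IH] Hs; first by exists 1, 1, 1; split.
have [|h [l [e [h0 l0 e0 He]]]] := IH; first by move=> B' B's; apply: Hs; rewrite inE B's orbT.
have [|[h' [l' [e' [phi [h'0 l'0 BE]]]]] B0] := Hs B; first by rewrite inE eqxx.
rewrite BE /test_ball /= in B0.
(* Half of the room left by the triangle inequality, since [wbounded] gives a weak inequality and
   the ball is open. *)
pose d := (e' - test_norm w h' l' (0 - phi)) / 2.
have d0 : 0 < d by rewrite /d; lra.
exists (Num.max h h'), (Num.max l l'), (Num.min e d).
rewrite !lt_max h0 l0 lt_min e0 d0; split => // psi Hpsi B'.
have mh : h <= Num.max h h' /\ h' <= Num.max h h' by rewrite !le_max !lexx orbT.
have ml : l <= Num.max l l' /\ l' <= Num.max l l' by rewrite !le_max !lexx orbT.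
rewrite inE => /predU1P[->|B's]; last first.
  apply: He B's; apply: wbounded_mono mh.1 (ltW l0) ml.1 _ => z zh.
  by apply: le_trans (Hpsi z zh) _; rewrite ge_min lexx.
rewrite BE /test_ball /=; apply: (@le_lt_trans _ _ (d + test_norm w h' l' (0 - phi))); last first.
  by rewrite /d; lra.
apply: test_norm_le => // z zh.
apply: (@le_trans _ _ (nc (psi z) * expR (wext w (l' * Re z)) +
   nc ((0 - phi : testfun w) z) * expR (wext w (l' * Re z)))).
  rewrite -mulrDl ler_wpM2r ?expR_ge0//.
  rewrite [X in nc X <= _](_ : _ = psi z + (0 - phi : testfun w) z); last by rewrite sub0r.
  exact: le_normcD.
apply: lerD; last exact: test_norm_wbounded.
have := wbounded_mono mh.2 (ltW l'0) ml.2 Hpsi.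
by move=> /(_ z zh)/le_trans; apply; rewrite ge_min lexx orbT.
Qed.

(** Continuity at 0 gives [nc (f psi) < 1] on a ball of a single norm, and homogeneity does the
    rest. *)
Lemma dual_bounded (f : dual w) : exists h l C : R, [/\ 0 < h, 0 < l, 0 <= C &
  forall (phi : testfun w) M, wbounded h l phi M -> nc (f phi) <= C * M].
Proof.
have /asboolP[lf cf] := dualP f.
have fD (k : cplx R) u v : f (k *: u + v) = k * f u + f v by exact: lf.
have f0 : f 0 = 0.
  by have := fD (-1) 0 0; rewrite scaler0 addr0 mulN1r addNr.
have fZ (k : cplx R) u : f (k *: u) = k * f u by rewrite -[_ *: _]addr0 fD f0 addr0.
have : nbhs (0 : testfun w) [set phi | nc (f phi) < 1].
  have /normc_cvgP/(_ 1 ltr01) := cf 0.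
  by apply: filterS => phi /=; rewrite f0 subr0.
rewrite nbhsE => -[B [[D sD DE] B0] BA].
rewrite -DE in B0 BA; have {B0} [U DU U0] := B0.
have UA : U `<=` [set phi | nc (f phi) < 1] by move=> x Ux; apply: BA; exists U.
have [E sE EU] := sD _ DU.
have [|h [l [e [h0 l0 e0 He]]]] := @test_subbase_nbhs0 (enum_fset E).
  move=> B' B'E; split; first exact: set_mem (sE _ B'E).
  by move: U0; rewrite -EU; apply.
exists h, l, (2 / e); split => //; first by rewrite divr_ge0// ltW.
have small (psi : testfun w) : wbounded h l psi e -> nc (f psi) < 1.
  by move=> /He H; apply: UA; rewrite -EU => B' B'E; exact: H.
move=> phi M HM.
have M0 : 0 <= M.
  by apply: le_trans _ (HM _ (strip0 h0)); rewrite mulr_ge0 ?normc_ge0 ?expR_ge0.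
(* [phi] is rescaled by its bound, which may be 0; hence the detour through every [m > M]. *)
suff H m : M < m -> nc (f phi) <= 2 / e * m.
  apply/ler_addgt0Pr => d d0.
  apply: le_trans (H (M + d / (2 / e)) _) _; first by rewrite ltrDl !divr_gt0.
  by rewrite mulrDr mulrCA divff ?mulr1// gt_eqF// divr_gt0.
move=> Mm; have m0 : 0 < m by lra.
have := small ((e / m)%:C *: phi); rewrite fZ Normc.normcM normc_real gtr0_norm ?divr_gt0//.
move=> /(_ _)/ltW; rewrite -ler_pdivlMl ?divr_gt0// invf_div mulr1 => H.
apply: le_trans (H _) _.
  move=> z zh; have -> : ((e / m)%:C *: phi : testfun w) z = (e / m)%:C * phi z by [].
  rewrite Normc.normcM normc_real gtr0_norm ?divr_gt0// -mulrA.
  rewrite -mulrAC ler_pdivrMr// ler_pM2l//.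
  exact: le_trans (HM z zh) (ltW Mm).
by rewrite mulrAC ler_wpM2r ?invr_ge0 ?ltW//; lra.
Qed.

Lemma bounded_dual (g : testfun w -> cplx R) h l C : 0 < h -> 0 < l -> 0 <= C -> linear g ->
  (forall (phi : testfun w) M, wbounded h l phi M -> nc (g phi) <= C * M) ->
  g \in @dual_pred R w.
Proof.
move=> h0 l0 C0 lg gb; apply/asboolP; split => // phi.
apply/(@normc_cvgP R (testfun w) (nbhs phi) (nbhs_filter phi)) => e e0.
have C1 : 0 < C + 1 by lra.
rewrite nbhsE; exists (test_ball h l (e / (C + 1)) phi).
  split; last first.
    rewrite /test_ball /= subrr.
    apply: le_lt_trans (test_norm_le h0 (_ : wbounded h l (0 : testfun w) 0)) _.
      by move=> z _; rewrite (Normc.normc0 R : nc ((0 : testfun w) z) = 0) mul0r.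
    by rewrite divr_gt0.
  exists [set test_ball h l (e / (C + 1)) phi]; last by rewrite bigcup_set1.
  move=> _ ->; apply: finI_from1; by exists h, l, (e / (C + 1)), phi.
move=> psi /= Hpsi.
have -> : g psi - g phi = g (psi - phi).
  by have := lg (-1) phi psi; rewrite !scaleN1r ![- _ + _]addrC => ->.
have t0 : 0 <= test_norm w h l (psi - phi).
  by apply: le_trans _ (test_norm_wbounded _ h0 l0 (strip0 h0)); rewrite mulr_ge0 ?normc_ge0 ?expR_ge0.
apply: le_lt_trans (gb _ _ (test_norm_wbounded (psi - phi) h0 l0)) _.
by move: Hpsi; rewrite /test_ball /= ltr_pdivlMr//; nra.
Qed.

(** Any test function with a nonzero value can be translated and normalised; by [expR_wext_split]
    translation preserves the decay after doubling [l] and widening the strip. If there is none, the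
    second alternative still yields [P 0 * phi zeta = phi zeta], the only use made of the
    normalisation. *)
Lemma cutoff_kernel_test : exists P : testfun w,
  P 0 = 1 \/ forall (phi : testfun w) z, phi z = 0.
Proof.
have [[phi [z0 Hphi]]|H] := pselect (exists (phi : testfun w) z, phi z <> 0); last first.
  by exists 0; right => phi z; apply: contrapT => Hz; apply: H; exists phi, z.
have phi0 : phi z0 != 0 by exact/eqP.
have /asboolP[dphi bphi] := testfunP phi.
pose P z : cplx R := (phi z0)^-1 * phi (z + z0).
suff HP : P \in test_pred w.
  by exists (Testfun HP); left; rewrite /= /P add0r mulVf.
apply/asboolP; split=> [z _|h l h0 l0].
  apply: derivableM; first exact: derivable_cst.
  apply: (@derivable_chain _ phi (fun z => z + z0)); first exact: dphi.
  by apply: derivableD; [exact: derivable_id|exact: derivable_cst].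
have hh : 0 < h + `|Im z0| by rewrite ltr_wpDr.
have ll : 0 < 2 * l by rewrite mulr_gt0.
have [M HM] := bphi _ _ hh ll.
exists ((nc (phi z0))^-1 * M * expR (wext w (2 * l * (- Re z0)))) => _ [z zh <-].
rewrite /P Normc.normcM Normc.normcV.
have zh' : strip (h + `|Im z0|) (z + z0).
  by rewrite /strip /= ImcD; apply: le_lt_trans (ler_normD _ _) _; rewrite ltrD2r.
have := HM _ (ex_intro2 _ _ _ zh' erefl); rewrite RecD => H.
have := expR_wext_split l (Re z) (Re z + Re z0).
have -> : Re z - (Re z + Re z0) = - Re z0 by ring.
move=> H2.
rewrite -(mulrA _ M) -(mulrA _ (nc (phi _))) ler_pM2l ?invr_gt0 ?normc_gt0//.
apply: le_trans (ler_wpM2l (normc_ge0 _) H2) _.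
apply: le_trans (ler_wpM2r (expR_ge0 _) H).
by rewrite (mulrA (nc _)).
Qed.

End weights.

(** * Integrals over the line with quadratic decay *)

Section line_integrals.
Context {R : realType}.
Local Notation mu := (@lebesgue_measure R).
Local Notation m := (fun x : R => (oneDsqr x)^-1).

Lemma integral_oneDsqrV : (\int[mu]_x (m x)%:E = pi%:E)%E.
Proof.
rewrite ge0_symfun_integralT.
- by rewrite -set_itvcy integral0y_oneDsqr -EFinM; congr EFin; field.
- by move=> x; rewrite invr_ge0.
- exact: continuous_oneDsqrV.
- by move=> x; rewrite /= /oneDsqr sqrrN.
Qed.

Lemma integrable_oneDsqrV : mu.-integrable setT (EFin \o m).
Proof.
apply/integrableP; split.
  apply/measurable_realfun.measurable_EFinP; apply: measurable_realfun.continuous_measurable_fun; exact: continuous_oneDsqrV.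
have -> : (\int[mu]_x `|(EFin \o m) x| = pi%:E)%E; last exact: ltry.
by rewrite -integral_oneDsqrV; apply: eq_integral => x _ /=; rewrite ger0_norm// invr_ge0.
Qed.

Definition oneDsqrV_tail (n : R) : R := Rintegral mu (~` `[- n, n]) m.

Lemma oneDsqrV_tail_atan n : 0 < n -> oneDsqrV_tail n = pi - 2 * atan n.
Proof.
move=> n0; have : Rintegral mu setT m = pi by rewrite /Rintegral integral_oneDsqrV.
rewrite -(setUv `[- n, n]) Rintegral_setU ?setUv//; last 3 first.
- by apply: measurableC.
- exact: integrable_oneDsqrV.
- by rewrite disj_set2E setICr.
have -> : Rintegral mu `[- n, n] m = 2 * atan n.
  rewrite /Rintegral (@continuous_FTC2 _ _ atan)/=.
  - by rewrite atanN opprK mulr2n mulrDl !mul1r.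
  - lra.
  - by apply: continuous_in_subspaceT => x _; exact: continuous_oneDsqrV.
  - split.
    + by move=> x _; exact: derivable_atan.
    + by apply: cvg_at_right_filter; exact: continuous_atan.
    + by apply: cvg_at_left_filter; exact: continuous_atan.
  - by move=> x _; rewrite derive1_atan.
by rewrite /oneDsqrV_tail => <-; rewrite addrC addKr.
Qed.

Lemma oneDsqrV_tail_small e : 0 < e -> exists2 n0, 0 < n0 & forall n, n0 <= n -> oneDsqrV_tail n <= e.
Proof.
move=> e0; have e20 : 0 < e / 2 by rewrite divr_gt0.
have /cvgrPdist_lt/(_ _ e20)[a [_ Ha]] := @cvgy_atan R.
exists (Num.max a 0 + 1); first by rewrite ltr_wpDl// le_max lexx orbT.
move=> n an; have [na n0] : a < n /\ 0 < n.
  have : a <= Num.max a 0 by rewrite le_max lexx.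
  have : 0 <= Num.max a 0 by rewrite le_max lexx orbT.
  lra.
rewrite oneDsqrV_tail_atan//; have := Ha _ na; rewrite ltr_norml => /andP[_]; lra.
Qed.

Lemma cintegrable_decay (g : R -> cplx R) B : (forall x, {for x, continuous g}) ->
  (forall x, nc (g x) <= B * m x) -> cintegrable setT g.
Proof.
move=> cg gB.
have dom (h : R -> R) : (forall x, {for x, continuous h}) -> (forall x, `|h x| <= B * m x) ->
    mu.-integrable setT (EFin \o h).
  move=> ch hB; apply: (@le_integrable _ _ _ mu setT measurableT _ (EFin \o (fun x => B * m x))) => //.
  - by apply/measurable_realfun.measurable_EFinP; exact: measurable_realfun.continuous_measurable_fun.
  - by move=> x _ /=; rewrite lee_fin; apply: le_trans (hB x) _; exact: ler_norm.
  - by apply: integrable_EFinZl => //; exact: integrable_oneDsqrV.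
split; apply: dom.
- move=> x; apply: (@continuous_comp _ (cplx R) _ g (@complex.Re R));
    [exact: cg|exact: continuous_Re].
- by move=> x; apply: le_trans (normr_Re _) (gB x).
- move=> x; apply: (@continuous_comp _ (cplx R) _ g (@complex.Im R));
    [exact: cg|exact: continuous_Im].
- by move=> x; apply: le_trans (normr_Im _) (gB x).
Qed.

Lemma normc_cRint_tail (g : R -> cplx R) B n : (forall x, {for x, continuous g}) ->
  (forall x, nc (g x) <= B * m x) ->
  nc (cRint setT g - cRint `[- n, n] g) <= 2 * (B * oneDsqrV_tail n).
Proof.
move=> cg gB; have Ig := cintegrable_decay cg gB.
have Is (D : set R) : measurable D -> cintegrable D g.
  by move=> mD; case: Ig => g1 g2; split; [move: g1|move: g2]; exact: integrableS.
have mC : measurable (~` `[- n, n] : set R) by exact: measurableC.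
have -> : cRint setT g - cRint `[- n, n] g = cRint (~` `[- n, n]) g.
  suff -> : cRint setT g = cRint `[- n, n] g + cRint (~` `[- n, n]) g.
    by rewrite addrC addKr.
  apply/eqP; rewrite eq_complex /= -(setUv `[- n, n]).
  case: Ig => g1 g2.
  by rewrite !Rintegral_setU ?setUv ?eqxx// disj_set2E setICr.
have Im : mu.-integrable (~` `[- n, n]) (EFin \o m).
  by apply: integrableS integrable_oneDsqrV.
rewrite /oneDsqrV_tail -RintegralZl//.
apply: normc_cRint => //; first exact: Is.
exact: integrable_EFinZl.
Qed.

End line_integrals.

Section functional_line_integral.
Context {R : realType}.
Variables (T : set (cplx R)) (wt : cplx R -> R) (L : (cplx R -> cplx R) -> cplx R) (C : R).
Hypotheses (wt0 : forall z, 0 < wt z) (C0 : 0 <= C)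
  (Llin : forall u v (k : cplx R), L (fun z => u z + k * v z) = L u + k * L v)
  (Lbd : forall v M, (forall z, T z -> nc (v z) * wt z <= M) -> nc (L v) <= C * M).
Local Notation m := (fun x : R => (oneDsqr x)^-1).

(** On [[- n, n]] the interchange is [functional_integral]. The tails on both sides are small
    because the decay [B * m x] holds uniformly over [T] and hence passes through [L]. *)
Lemma functional_line_integral (g : R -> cplx R -> cplx R) B : 0 <= B ->
  (forall zeta, T zeta -> forall x, {for x, continuous (g^~ zeta)}) ->
  (forall x, {for x, continuous (fun x => L (g x))}) ->
  (forall zeta, T zeta -> forall x, nc (g x zeta) * wt zeta <= B * m x) ->
  (forall n, 0 < n -> exists2 K, 0 <= K & forall zeta, T zeta ->
     forall x y, - n <= x <= n -> - n <= y <= n ->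
     nc (g x zeta - g y zeta) * wt zeta <= K * `|x - y|) ->
  cRint setT (fun x => L (g x)) = L (fun zeta => cRint setT (g^~ zeta)).
Proof.
move=> B0 cg cLg gB lip; apply/eqP; rewrite -subr_eq0; apply/eqP/Normc.eq0_normc/eqP.
rewrite eq_le normc_ge0 andbT; apply/ler_addgt0Pr => e e0; rewrite add0r.
have K0 : 0 < 4 * (C * B) + 1 by have := mulr_ge0 C0 B0; lra.
have [n n0 /(_ n (lexx n)) tn] := @oneDsqrV_tail_small R _ (divr_gt0 e0 K0).
have [K K1 HK] := lip _ n0.
have nn : - n <= n by lra.
have E := @functional_integral R T wt L C wt0 Llin Lbd g (- n) n K nn K1
  (fun zeta Tz x _ => cg zeta Tz x) (fun x _ => cLg x) HK.
have -> : cRint setT (fun x => L (g x)) - L (fun zeta => cRint setT (g^~ zeta)) =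
  (cRint setT (fun x => L (g x)) - cRint `[- n, n] (fun x => L (g x))) -
  L (fun zeta => cRint setT (g^~ zeta) - cRint `[- n, n] (g^~ zeta)).
  by rewrite -E (functionalB Llin); ring.
apply: le_trans (le_normcD _ _) _; rewrite normcN.
have h1 : nc (cRint setT (fun x => L (g x)) - cRint `[- n, n] (fun x => L (g x))) <=
    2 * (C * B * oneDsqrV_tail n).
  by apply: normc_cRint_tail => // x; rewrite -mulrA; apply: Lbd => zeta Tz; exact: gB.
have h2 : nc (L (fun zeta => cRint setT (g^~ zeta) - cRint `[- n, n] (g^~ zeta))) <=
    C * (2 * (B * oneDsqrV_tail n)).
  apply: Lbd => zeta Tz; rewrite -ler_pdivlMr//.
  have -> : 2 * (B * oneDsqrV_tail n) / wt zeta = 2 * (B / wt zeta * oneDsqrV_tail n) by ring.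
  apply: normc_cRint_tail; first exact: cg.
  by move=> x; rewrite mulrAC ler_pdivlMr//; exact: gB.
apply: le_trans (lerD h1 h2) _.
have t0 : 0 <= oneDsqrV_tail n by apply: Rintegral_ge0 => x _; rewrite invr_ge0.
have -> : 2 * (C * B * oneDsqrV_tail n) + C * (2 * (B * oneDsqrV_tail n)) = 4 * (C * B) * oneDsqrV_tail n by ring.
move: tn; rewrite ler_pdivlMr// => tn; rewrite mulrC.
by apply: le_trans tn; rewrite ler_wpM2l// lerDl.
Qed.

End functional_line_integral.

(** * The Cauchy transform of a functional *)

Section cauchy_transform.
Context {R : realType}.
Variable w : R -> R.
Hypotheses (weight_w : weight_function w) (delta_w : cond_delta w).
Variables (T : set (cplx R)) (L : (cplx R -> cplx R) -> cplx R) (h l C : R).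
Hypotheses (h0 : 0 < h) (l0 : 0 < l) (C0 : 0 <= C) (Th : T `<=` strip h).
Let wt (z : cplx R) : R := expR (wext w (l * Re z)).
Hypotheses
  (Llin : forall u v (k : cplx R), L (fun z => u z + k * v z) = L u + k * L v)
  (Lbd : forall v M, (forall z, T z -> nc (v z) * wt z <= M) -> nc (L v) <= C * M).
Variable P : testfun w.
Hypothesis P1 : P 0 = 1 \/ forall (phi : testfun w) z, phi z = 0.
Local Notation m := (fun x : R => (oneDsqr x)^-1).

Let wt0 z : 0 < wt z. Proof. exact: expR_gt0. Qed.

Lemma test_derivable (phi : testfun w) z : derivable phi z 1.
Proof. by have /asboolP[H _] := testfunP phi; exact: H. Qed.

Lemma test_decay (phi : testfun w) (r l' : R) : 0 < r -> 0 < l' ->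
  exists2 M, 0 <= M & wbounded w r l' phi M.
Proof.
move=> r0 l'0; have /asboolP[_ H] := testfunP phi; have [M HM] := H _ _ r0 l'0.
exists M; last by move=> z zr; apply: HM; exists z.
apply: le_trans (HM _ (ex_intro2 _ _ _ (strip0 r0) erefl)).
by rewrite mulr_ge0 ?normc_ge0 ?expR_ge0.
Qed.

(** [2 * l] is the growth parameter of the Cauchy transform, so this is the decay that the product
    of the transform with [phi] needs on horizontal lines. *)
Lemma test_decay_sqr (phi : testfun w) (r : R) : 0 < r ->
  exists2 M, 0 <= M & forall z, strip r z ->
    nc (phi z) * expR (wext w (2 * l * Re z)) <= M * m (Re z).
Proof.
move=> r0; have l20 : 0 < 2 * l by rewrite mulr_gt0.
have [l' [K [l'0 K0 HK]]] := weight_decay weight_w delta_w l20.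
have [M M0 HM] := test_decay phi r0 l'0.
exists (M * K); first exact: mulr_ge0.
move=> z zr; apply: le_trans (ler_wpM2l (normc_ge0 _) (HK _)) _.
have m0 : 0 <= K * m (Re z) by rewrite mulr_ge0// invr_ge0.
have := ler_wpM2l m0 (HM z zr).
by rewrite /oneDsqr; congr (_ <= _); ring.
Qed.

Lemma test_bounded (phi : testfun w) (r : R) : 0 < r ->
  exists2 M, 0 <= M & forall z, strip r z -> nc (phi z) <= M * m (Re z).
Proof.
move=> r0; have [M M0 HM] := test_decay_sqr phi r0; exists M => // z zr.
apply: le_trans (HM z zr); rewrite ler_peMr ?normc_ge0//.
by rewrite -expR0 ler_expR (wext_ge0 weight_w).
Qed.

Definition kernel (z zeta : cplx R) : cplx R := P (zeta - z) * (zeta - z)^-1.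

Definition cauchy_transform (z : cplx R) : cplx R :=
  ('i * (2 * pi)%:C)^-1 * L (kernel z).

Lemma kernel_derivable z zeta : z != zeta -> derivable (kernel^~ zeta) z 1.
Proof.
move=> zz; have dB : derivable (fun z : cplx R => zeta - z) z 1.
  by apply: derivableB; [exact: derivable_cst|exact: derivable_id].
have dP : derivable (fun z : cplx R => P (zeta - z) : cplx R) z 1.
  apply: (@derivable_chain _ P (fun z => zeta - z)); last exact: dB.
  exact: test_derivable.
have dV : derivable (fun z : cplx R => (zeta - z)^-1 : cplx R) z 1.
  by apply: derivableV; [rewrite subr_eq0 eq_sym|exact: dB].
exact: (derivableM dP dV).
Qed.

(** The weight at [zeta] is split by [expR_wext_split]: the part in [Re zeta - Re z] is absorbed by
    the decay of [P], the part in [Re z] remains as growth. *)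
Lemma kernel_bound (r : R) : 0 < r -> exists2 M, 0 <= M &
  forall z zeta d, 0 < d -> T zeta -> `|Im z| < r -> d <= nc (zeta - z) ->
    nc (kernel z zeta) * wt zeta <= M / d * expR (wext w (2 * l * Re z)).
Proof.
move=> r0; have hr : 0 < h + r by exact: addr_gt0.
have l20 : 0 < 2 * l by rewrite mulr_gt0.
have [M M0 HM] := test_decay P hr l20; exists M => // z zeta d d0 /Th zh zr dz.
rewrite /kernel Normc.normcM Normc.normcV.
have zz : strip (h + r) (zeta - z).
  rewrite /strip /= ImcD ImcN; apply: le_lt_trans (ler_normB _ _) _.
  by apply: ltrD.
have := HM _ zz; rewrite RecD RecN => H.
have e1 := expR_wext_split weight_w l (Re zeta) (Re z).
have n0 : 0 <= nc (P (zeta - z)) / nc (zeta - z) by rewrite divr_ge0 ?normc_ge0.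
apply: le_trans (ler_wpM2l n0 e1) _.
have -> : nc (P (zeta - z)) / nc (zeta - z) *
  (expR (wext w (2 * l * Re z)) * expR (wext w (2 * l * (Re zeta - Re z)))) =
  (nc (P (zeta - z)) * expR (wext w (2 * l * (Re zeta - Re z)))) / nc (zeta - z) *
   expR (wext w (2 * l * Re z)) by ring.
rewrite ler_wpM2r ?expR_ge0// ler_pM ?invr_ge0 ?normc_ge0 ?mulr_ge0 ?expR_ge0 ?normc_ge0//.
by rewrite lef_pV2// posrE; exact: lt_le_trans dz.
Qed.

Lemma square_dist (z0 z zeta : cplx R) (d : R) : in_square z0 (d / 4) z -> d <= nc (zeta - z0) ->
  d / 2 <= nc (zeta - z).
Proof.
rewrite /in_square /in_rect => zs dz.
have -> : zeta - z = (zeta - z0) - (z - z0) by ring.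
apply: le_trans (normc_lerB _ _).
have : nc (z - z0) <= d / 2.
  apply: le_trans (normc_le_ReIm _) _; rewrite RecD RecN ImcD ImcN.
  have : `|Re z - Re z0| <= d / 4 by rewrite ler_norml; lra.
  have : `|Im z - Im z0| <= d / 4 by rewrite ler_norml; lra.
  lra.
lra.
Qed.

(** The factor [psi] is 1 when the transform is differentiated and a test function when it is
    integrated along a line. The latter use needs one [M] for all centres [z0] on a segment, hence
    the box of size [rho]. *)
Lemma kernel_square (psi : cplx R -> cplx R) (rho d : R) : 0 < d -> 0 < rho ->
  (forall z, derivable psi z 1) ->
  (forall r, 0 < r -> exists2 M, 0 <= M & forall z, strip r z -> nc (psi z) <= M) ->
  exists2 M, 0 <= M & forall z0, `|Re z0| <= rho -> `|Im z0| <= rho ->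
    (forall zeta, T zeta -> d <= nc (zeta - z0)) ->
    forall zeta, T zeta -> forall z, in_square z0 (d / 4) z ->
      derivable (fun z => kernel z zeta * psi z) z 1 /\
      nc (kernel z zeta * psi z) * wt zeta <= M.
Proof.
move=> d0 rho0 dpsi bpsi; have r0 : 0 < rho + d by exact: addr_gt0.
have [M1 M10 HM1] := kernel_bound r0; have [M2 M20 HM2] := bpsi _ r0.
exists (M1 / (d / 2) * expR (wext w (2 * l * (rho + d))) * M2).
  by rewrite !mulr_ge0 ?expR_ge0// invr_ge0; lra.
move=> z0 z0r z0i dist zeta Tz z zs; have zd := square_dist zs (dist _ Tz).
have zn : z != zeta.
  by apply/eqP => zE; move: zd; rewrite zE subrr (Normc.normc0 R); lra.
have [zr zi] : `|Re z| < rho + d /\ `|Im z| < rho + d.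
  by move: zs z0r z0i; rewrite /in_square /in_rect !ler_norml !ltr_norml; lra.
split; first by apply: derivableM; [exact: kernel_derivable|exact: dpsi].
rewrite Normc.normcM mulrAC; apply: ler_pM; rewrite ?mulr_ge0 ?normc_ge0 ?(ltW (wt0 _))//.
  apply: le_trans (HM1 _ _ (d / 2) _ Tz zi zd) _; first lra.
  rewrite ler_wpM2l//; first by rewrite mulr_ge0// invr_ge0; lra.
  rewrite ler_expR (wext_le weight_w)// normrM [leRHS]normrM ler_wpM2l//.
  by rewrite [leRHS]ger0_norm; lra.
by apply: HM2; exact: zi.
Qed.

Let cst1_bounded (r : R) : 0 < r ->
  exists2 M, 0 <= M & forall z : cplx R, strip r z -> nc (1 : cplx R) <= M.
Proof. by move=> _; exists 1 => // z _; rewrite (Normc.normc1 R). Qed.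

Lemma cauchy_transform_derivable z0 (d : R) : 0 < d ->
  (forall zeta, T zeta -> d <= nc (zeta - z0)) -> derivable cauchy_transform z0 1.
Proof.
move=> d0 dist; apply: derivableM; first exact: derivable_cst.
pose rho := `|Re z0| + `|Im z0| + 1.
have [rho0 zr zi] : [/\ 0 < rho, `|Re z0| <= rho & `|Im z0| <= rho].
  by have := normr_ge0 (Re z0); have := normr_ge0 (Im z0); split; rewrite /rho; lra.
have [M M0 HM] := @kernel_square (fun=> 1) rho d d0 rho0
  (fun z => derivable_cst _ _ _) cst1_bounded.
have -> : (fun z => L (kernel z)) = (fun z => L (fun zeta => kernel z zeta * 1)).
  by apply/funext => z; congr L; apply/funext => zeta; rewrite mulr1.
apply: (@functional_derivable R T wt L C wt0 C0 Llin Lbd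
  (fun z zeta => kernel z zeta * 1) z0 (d / 4) M) => //; first by rewrite divr_gt0.
exact: HM.
Qed.

Lemma cauchy_transform_growth (D : set (cplx R)) (r d : R) : 0 < r -> 0 < d ->
  (forall z, D z -> `|Im z| < r /\ forall zeta, T zeta -> d <= nc (zeta - z)) ->
  growth_on w D (2 * l) cauchy_transform.
Proof.
move=> r0 d0 HD; have [M M0 HM] := kernel_bound r0.
exists (nc ('i * (2 * pi)%:C : cplx R)^-1 * (C * (M / d))) => _ [z Dz <-].
have [zr dist] := HD _ Dz.
rewrite /cauchy_transform Normc.normcM -mulrA ler_wpM2l ?normc_ge0//.
rewrite expRN ler_pdivrMr ?expR_gt0// -(mulrA C).
by apply: Lbd => zeta Tz; exact: HM _ (dist _ Tz).
Qed.

Lemma strip_dist (z zeta : cplx R) : T zeta -> h + 1 <= `|Im z| -> 1 <= nc (zeta - z).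
Proof.
move=> /Th zh zi; apply: le_trans (normr_Im _); rewrite ImcD ImcN distrC.
by apply: le_trans (lerB_dist _ _); move: zh; rewrite /strip /=; lra.
Qed.

Lemma kernel_decay (phi : testfun w) (y : R) : h + 1 <= `|y| ->
  exists2 B, 0 <= B & forall zeta, T zeta -> forall x,
    nc (kernel (x +i* y) zeta * phi (x +i* y)) * wt zeta <= B * m x.
Proof.
move=> hy; have r0 : 0 < `|y| + 1 by rewrite ltr_wpDl.
have [M1 M10 HM1] := kernel_bound r0; have [M2 M20 HM2] := test_decay_sqr phi r0.
exists (M1 * M2); first exact: mulr_ge0.
move=> zeta Tz x; have yr : `|Im (x +i* y : cplx R)| < `|y| + 1 by rewrite /= ltrDl.
have d1 : 1 <= nc (zeta - (x +i* y)) by exact: strip_dist.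
have H1 := HM1 _ _ 1 ltr01 Tz yr d1; have H2 := HM2 (x +i* y) yr.
rewrite Normc.normcM mulrAC.
apply: le_trans (ler_wpM2r (normc_ge0 _) H1) _.
rewrite divr1 -(mulrA M1) -(mulrA M1) ler_wpM2l//.
by rewrite mulrC.
Qed.

Lemma hline_continuous (G : cplx R -> cplx R) (x y : R) : derivable G (x +i* y) 1 ->
  {for x, continuous (fun x => G (x +i* y))}.
Proof.
move=> dG; apply: (@continuous_comp _ _ _ (fun x : R => x +i* y : cplx R) G).
  exact: continuous_hline.
exact: derivable_continuous dG.
Qed.

Lemma kernel_hline_derivable (phi : testfun w) zeta (x y : R) : T zeta -> h + 1 <= `|y| ->
  derivable (fun z => kernel z zeta * phi z) (x +i* y) 1.
Proof.
move=> Tz hy; apply: derivableM; last exact: test_derivable.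
apply: kernel_derivable; apply/eqP => zE.
by have := @strip_dist (x +i* y) zeta Tz hy; rewrite zE subrr (Normc.normc0 R); lra.
Qed.

Lemma kernel_lipschitz (phi : testfun w) (y n : R) : h + 1 <= `|y| -> 0 < n ->
  exists2 K, 0 <= K & forall zeta, T zeta ->
     forall x x', - n <= x <= n -> - n <= x' <= n ->
     nc (kernel (x +i* y) zeta * phi (x +i* y) - kernel (x' +i* y) zeta * phi (x' +i* y))
       * wt zeta <= K * `|x - x'|.
Proof.
move=> hy n0; have rho0 : 0 < n + `|y| by rewrite ltr_pwDl.
have bphi r : 0 < r -> exists2 M, 0 <= M & forall z, strip r z -> nc (phi z) <= M.
  move=> r0; have [M M0 HM] := test_bounded phi r0; exists M => // z /HM/le_trans; apply.
  by rewrite ler_piMr// invf_le1.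
have [M M0 HM] := @kernel_square phi _ 1 ltr01 rho0 (@test_derivable phi) bphi.
(* [128 = 32 / (1 / 4)], the Lipschitz constant coming from squares of half-side [1 / 4]. *)
exists (128 * M); first by rewrite mulr_ge0.
move=> zeta Tz x x' xn xn'.
have sq (u : R) : - n <= u <= n -> forall zeta, T zeta ->
    forall z, in_square (u +i* y) (1 / 4) z ->
      derivable (fun z => kernel z zeta * phi z) z 1 /\
      nc (kernel z zeta * phi z) * wt zeta <= M.
  move=> un; apply: HM => /=.
  - by apply: (@le_trans _ _ n); rewrite ?ler_norml// lerDl.
  - by rewrite lerDr ltW.
  - by move=> zeta' Tz'; exact: strip_dist.
(* The Cauchy estimate only covers points closer than 1/8. *)
have [far|near] := ltP (1 / 8) `|x - x'|.
  have b (u : R) : - n <= u <= n -> nc (kernel (u +i* y) zeta * phi (u +i* y)) * wt zeta <= M.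
    move=> un; have [] // := sq u un zeta Tz (u +i* y).
    by have := @in_squareP R (u +i* y) (1 / 4) 0; rewrite addr0 (Normc.normc0 R); apply; rewrite divr_ge0.
  apply: (@le_trans _ _ (M + M)).
    apply: le_trans (lerD (b x xn) (b x' xn')).
    rewrite -mulrDl ler_wpM2r ?(ltW (wt0 _))//.
    by apply: le_trans (le_normcD _ _) _; rewrite normcN.
  by have := ler_wpM2l M0 (ltW far); lra.
have xE : x +i* y = (x' +i* y) + (x - x')%:C :> cplx R.
  by apply/eqP; rewrite eq_complex /= addr0 addrC subrK !eqxx.
have := @functional_lipschitz R T wt wt0 (fun z zeta => kernel z zeta * phi z)
  (x' +i* y) (1 / 4) M (x - x')%:C _ M0 (sq x' xn') _ zeta Tz.
rewrite -xE normc_real; move=> H; apply: le_trans (H _ _) _; [lra|lra|].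
by rewrite le_eqVlt; apply/orP; left; apply/eqP; field.
Qed.

Lemma cauchy_transform_line (phi : testfun w) (y : R) : h + 1 <= `|y| ->
  cRint setT (fun x => cauchy_transform (x +i* y) * phi (x +i* y)) =
  ('i * (2 * pi)%:C)^-1 *
    L (fun zeta => cRint setT (fun x => kernel (x +i* y) zeta * phi (x +i* y))).
Proof.
move=> hy; pose g (x : R) zeta := kernel (x +i* y) zeta * phi (x +i* y).
have [B B0 HB] := kernel_decay phi hy.
have gE (x : R) : L (g x) = L (kernel (x +i* y)) * phi (x +i* y).
  rewrite mulrC -(functionalZ Llin); congr L.
  by apply/funext => zeta; rewrite /g mulrC.
have FE (x : R) : cauchy_transform (x +i* y) * phi (x +i* y) = ('i * (2 * pi)%:C)^-1 * L (g x).
  by rewrite gE /cauchy_transform mulrA.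
have c0 : ('i * (2 * pi)%:C : cplx R) != 0.
  apply/eqP => /(congr1 (@complex.Im R)); rewrite /= mul0r mul1r add0r => /eqP.
  by rewrite mulf_eq0 pnatr_eq0 /= gt_eqF// pi_gt0.
have cLg (x : R) : {for x, continuous (fun x => L (g x))}.
  have -> : (fun x => L (g x)) = fun x => ('i * (2 * pi)%:C) *
      (cauchy_transform (x +i* y) * phi (x +i* y)).
    by apply/funext => u; rewrite FE mulrA divff// mul1r.
  apply: (@hline_continuous (fun z => ('i * (2 * pi)%:C) * (cauchy_transform z * phi z))).
  apply: derivableM; first exact: derivable_cst.
  apply: derivableM; last exact: test_derivable.
  apply: (@cauchy_transform_derivable _ 1) => // zeta Tz; exact: strip_dist.
have cLB (x : R) : nc (L (g x)) <= C * B * m x.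
  by rewrite -mulrA; apply: Lbd => zeta Tz; exact: HB.
rewrite (eq_cRint (fun x _ => FE x)) cRintZ//; last exact: cintegrable_decay cLB.
have cg zeta (x : R) : T zeta -> {for x, continuous (g^~ zeta)}.
  move=> Tz; apply: (@hline_continuous (fun z => kernel z zeta * phi z)).
  exact: kernel_hline_derivable.
have E := @functional_line_integral R T wt L C wt0 C0 Llin Lbd g B B0
  (fun zeta Tz x => cg zeta x Tz) cLg HB (fun n n0 => kernel_lipschitz phi hy n0).
exact: (congr1 (fun u => ('i * (2 * pi)%:C)^-1 * u) E).
Qed.

(** Cauchy's formula on the rectangle [[- n, n]] by [[- k, k]]. As [n] grows, the decay of [phi]
    makes the vertical sides vanish and the horizontal ones tend to full lines. The sign is that of
    [(zeta - z)^-1 = - (z - zeta)^-1]. *)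
Lemma kernel_residue (phi : testfun w) (zeta : cplx R) (k : R) : T zeta -> h + 1 <= k ->
  cRint setT (fun x => kernel (x +i* - k) zeta * phi (x +i* - k)) -
  cRint setT (fun x => kernel (x +i* k) zeta * phi (x +i* k)) =
  - ('i * (2 * pi)%:C * (P 0 * phi zeta)).
Proof.
move=> Tz hk; have k0 : 0 < k by apply: lt_le_trans hk; rewrite addr_gt0.
have hk1 : h + 1 <= `|k| by rewrite gtr0_norm.
have hk2 : h + 1 <= `|- k| by rewrite normrN.
pose c : cplx R := 'i * (2 * pi)%:C.
pose g y (x : R) := kernel (x +i* y) zeta * phi (x +i* y).
have gB y : h + 1 <= `|y| -> exists2 B, 0 <= B & forall x, nc (g y x) <= B * m x.
  move=> hy; have [B B0 HB] := kernel_decay phi hy.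
  exists (B / wt zeta) => [|x]; first by rewrite divr_ge0// ltW.
  by rewrite mulrAC ler_pdivlMr//; exact: HB.
have cg y : h + 1 <= `|y| -> forall x, {for x, continuous (g y)}.
  move=> hy x; apply: (@hline_continuous (fun z => kernel z zeta * phi z)).
  exact: kernel_hline_derivable.
have [B1 B10 HB1] := gB _ hk1; have [B2 B20 HB2] := gB _ hk2.
have hk0 : 0 < h + k + 1 by rewrite !addr_gt0.
have k10 : 0 < k + 1 by exact: addr_gt0.
have [MP MP0 HMP] := test_bounded P hk0; have [M M0 HM] := test_bounded phi k10.
(* The two tails contribute [2 * B1] and [2 * B2]; the two vertical sides, of length [2 * k] each,
   contribute the last term. *)
pose K := 2 * B1 + 2 * B2 + 8 * k * MP * M.
have K0 : 0 <= K by rewrite /K !addr_ge0// !mulr_ge0// ltW.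
have K1 : 0 < K + 1 by lra.
apply/eqP; rewrite -subr_eq0 opprK; apply/eqP/Normc.eq0_normc/eqP.
rewrite eq_le normc_ge0 andbT; apply/ler_addgt0Pr => e e0; rewrite add0r.
have e'0 : 0 < e / (K + 1) by rewrite divr_gt0.
have [n0 n00 Hn0] := oneDsqrV_tail_small e'0.
(* [n0] controls the tails, [|Re zeta| + 1] keeps the vertical sides at distance at least 1 from
   [zeta], and the last summand makes [m n] at most [e / (K + 1)]. *)
pose n := n0 + `|Re zeta| + 1 + (e / (K + 1))^-1.
have ei0 : 0 < (e / (K + 1))^-1 by rewrite invr_gt0.
have Rz := normr_ge0 (Re zeta).
have n0n : n0 <= n by rewrite /n; lra.
have nz : `|Re zeta| + 1 <= n by rewrite /n; lra.
have tn := Hn0 _ n0n; have nn0 : 0 < n by lra.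
have mn : m n <= e / (K + 1).
  rewrite -[leRHS]invrK lef_pV2 ?posrE//.
  rewrite /oneDsqr; have : n <= 1 + n ^+ 2 by nra.
  by apply: le_trans; rewrite /n; lra.
have dpsi z : derivable (fun z => - (P (zeta - z) * phi z) : cplx R) z 1.
  apply: derivableN; apply: derivableM; last exact: test_derivable.
  apply: (@derivable_chain _ P (fun z => zeta - z)); first exact: test_derivable.
  by apply: derivableB; [exact: derivable_cst|exact: derivable_id].
have zh := Th Tz; rewrite /strip /= in zh.
have zr : - n < Re zeta < n by have := ler_norm (Re zeta); have := ler_norm (- Re zeta); rewrite normrN; lra.
have hk' : h <= k by apply: le_trans hk; rewrite lerDl.
have zi : - k < Im zeta < k by move: zh; rewrite ltr_norml; lra.
have J := @cauchy_formula R (- n) n (- k) k _ zeta zr zi (fun z _ => dpsi z).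
have JE : rect_int (- n) n (- k) k (fun z => kernel z zeta * phi z) =
    - (c * (P 0 * phi zeta)).
  transitivity (rect_int (- n) n (- k) k
      (fun z => - (P (zeta - z) * phi z) * (z - zeta)^-1)).
    apply: eq_rect_int => [||z _]; [lra|lra|].
    by rewrite /kernel -[z - zeta]opprB invrN mulrNN mulrAC.
  by rewrite J subrr mulrN.
have side (u : R) : n = `|u| -> nc (cRint `[- k, k] (fun y => kernel (u +i* y) zeta * phi (u +i* y)))
    <= 2 * (MP * M * m n) * (k - - k).
  move=> un; have un1 (y : R) : 1 <= nc (zeta - (u +i* y)).
    apply: le_trans (normr_Re _); rewrite RecD RecN /= distrC.
    by apply: le_trans (lerB_dist _ _); lra.
  apply: normc_cRint_itv; first lra.
    apply: (@cintegrable_vline R _ _ u (fun z => kernel z zeta * phi z)) => y _.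
    apply: derivable_continuous; apply: derivableM; last exact: test_derivable.
    apply: kernel_derivable; apply/eqP => zE.
    by have := un1 y; rewrite zE subrr (Normc.normc0 R); lra.
  move=> y yk; rewrite Normc.normcM -mulrA.
  apply: ler_pM; rewrite ?normc_ge0//.
    rewrite Normc.normcM Normc.normcV; apply: (@le_trans _ _ (nc (P (zeta - (u +i* y))))).
      by rewrite ler_piMr ?normc_ge0// invf_le1//; exact: lt_le_trans (un1 y).
    apply: le_trans (HMP _ _) _; last by rewrite ler_piMr// invf_le1//; exact: lt_le_trans ltr01 (oneDsqr_ge1 _).
    by rewrite /strip /= ltr_norml; move: zh; rewrite ltr_norml ImcD ImcN /=; lra.
  have -> : m n = m u by rewrite /oneDsqr un real_normK// num_real.
  by apply: HM; rewrite /strip /= ltr_norml; lra.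
have sr := side n (esym (gtr0_norm nn0)).
have sl : nc (cRint `[- k, k] (fun y => kernel (- n +i* y) zeta * phi (- n +i* y))) <=
  2 * (MP * M * m n) * (k - - k) by apply: side; rewrite normrN gtr0_norm.
have t1 := normc_cRint_tail n (cg _ hk1) HB1.
have t2 := normc_cRint_tail n (cg _ hk2) HB2.
move: JE; rewrite /rect_int -/(g k) -/(g (- k)).
set E1 := cRint setT _; set E2 := cRint setT _.
set a1 := cRint `[- n, n] _; set a2 := cRint `[- n, n] _.
set b1 := cRint `[- k, k] _; set b2 := cRint `[- k, k] _ => JE.
have -> : E1 - E2 + c * (P 0 * phi zeta) = (E1 - a1) - (E2 - a2) - 'i * (b1 - b2).
  rewrite -[c * _]opprK -JE; ring.
have tB (u v : cplx R) : nc (u - v) <= nc u + nc v.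
  by apply: le_trans (le_normcD _ _) _; rewrite normcN.
apply: le_trans (tB _ _) _; rewrite Normc.normcM normc_i mul1r.
apply: le_trans (lerD (tB _ _) (tB _ _)) _.
apply: le_trans (lerD (lerD t2 t1) (lerD sr sl)) _.
apply: (@le_trans _ _ (K * (e / (K + 1)))); last first.
  by rewrite mulrCA ler_piMr ?(ltW e0)// ler_pdivrMr//; lra.
have -> : K * (e / (K + 1)) = 2 * B2 * (e / (K + 1)) + 2 * B1 * (e / (K + 1)) +
   8 * k * MP * M * (e / (K + 1)) by rewrite /K; ring.
apply: lerD.
  by rewrite !(mulrA 2) lerD// ler_wpM2l// mulr_ge0.
have -> : 2 * (MP * M * m n) * (k - - k) + 2 * (MP * M * m n) * (k - - k) =
  8 * k * MP * M * m n by ring.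
by rewrite ler_wpM2l// !mulr_ge0// ltW.
Qed.

Lemma notin_closure_strip (z : cplx R) b : ~ closure (strip b) z -> b <= `|Im z|.
Proof.
by move=> nz; rewrite leNgt; apply/negP => zb; apply: nz; exact: subset_closure.
Qed.

(* With [h + 1] in place of [h], a point outside the closed strip is at distance
   at least 1 from [T]. *)
Lemma cauchy_transform_is_bv (f : dual w) : (forall phi : testfun w, f phi = L phi) ->
  is_bv cauchy_transform f.
Proof.
move=> fL; exists (h + 1), (2 * l); split.
- by rewrite addr_gt0.
- by rewrite mulr_gt0.
- move=> z /notin_closure_strip zh; apply: (@cauchy_transform_derivable _ 1) => // zeta Tz.
  exact: strip_dist.
- move=> r hr; apply: (@cauchy_transform_growth _ r 1) => //; first by apply: lt_trans hr; rewrite addr_gt0.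
  by move=> z [zr /notin_closure_strip zh]; split => // zeta Tz; exact: strip_dist.
move=> k hk phi.
have k0 : 0 < k by apply: lt_trans hk; rewrite addr_gt0.
have hk1 : h + 1 <= `|k| by rewrite gtr0_norm// ltW.
have hk2 : h + 1 <= `|- k| by rewrite normrN.
have E1 := cauchy_transform_line phi hk1.
have E2 := cauchy_transform_line phi hk2.
pose c : cplx R := 'i * (2 * pi)%:C.
have c0 : c != 0.
  apply/eqP => /(congr1 (@complex.Im R)); rewrite /= mul0r mul1r add0r => /eqP.
  by rewrite mulf_eq0 pnatr_eq0 /= gt_eqF// pi_gt0.
have -> : Gamma_integral k (fun z => cauchy_transform z * phi z) =
    c^-1 * L (fun zeta => cRint setT (fun x => kernel (x +i* - k) zeta * phi (x +i* - k)))
    - c^-1 * L (fun zeta => cRint setT (fun x => kernel (x +i* k) zeta * phi (x +i* k))).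
  exact: (congr2 (fun u v => u - v) E2 E1).
rewrite -mulrBr -(functionalB Llin).
have -> : L (fun zeta => cRint setT (fun x => kernel (x +i* - k) zeta * phi (x +i* - k))
    - cRint setT (fun x => kernel (x +i* k) zeta * phi (x +i* k))) =
    L (fun zeta => - c * phi zeta).
  apply: (functional_eq Llin Lbd) => zeta Tz.
  apply: etrans (kernel_residue phi Tz (ltW hk)) _; rewrite -/c mulNr; congr (- (_ * _)).
  by case: P1 => [->|z0]; [rewrite mul1r|rewrite !z0 mulr0].
rewrite (functionalZ Llin) mulrA mulrN mulVf// mulN1r opprK; exact: fL.
Qed.

(** Analyticity above [Om] asks for a positive distance to [T] at each point separately, growth for
    a common one above each closed [K]. Off the strip of half-width [h + 1] the distance is at least
    1 anyway. *)
Lemma cauchy_transform_vanishes (f : dual w) (Om : set (\bar R)) :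
  (forall phi : testfun w, f phi = L phi) ->
  (forall x, Om x%:E -> exists2 d, 0 < d &
     forall z zeta, Re z = x -> T zeta -> d <= nc (zeta - z)) ->
  (forall K : set (\bar R), closed K -> K `<=` Om -> exists2 d, 0 < d &
     forall z zeta, K (Re z)%:E -> T zeta -> d <= nc (zeta - z)) ->
  vanishes_on Om f.
Proof.
move=> fL dOm dK; exists cauchy_transform; last exact: cauchy_transform_is_bv.
have an (b r : R) (A : set (\bar R)) : h + 1 <= b -> A `<=` Om ->
    analytic_on (strip2_over b r A) cauchy_transform.
  move=> hb AOm z [[zr /notin_closure_strip zb]|[Az _]].
    apply: (@cauchy_transform_derivable _ 1) => // zeta Tz.
    by apply: strip_dist Tz _; exact: le_trans zb.
  have [d d0 Hd] := dOm _ (AOm _ Az).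
  by apply: (@cauchy_transform_derivable _ d) => // zeta Tz; exact: Hd.
exists (2 * l), (h + 1); split; [by rewrite mulr_gt0|by rewrite addr_gt0|move=> r hr].
split; first exact: an.
move=> K cK _ _ KOm b r' hb br' r'r.
have KOm' : K° `<=` Om := subset_trans (@interior_subset _ K) KOm.
split; first by apply: an => //; exact: ltW.
have [d d0 Hd] := dK K cK KOm.
(* The distance is at least 1 off the closed strip and at least [d] above [K]. *)
apply: (@cauchy_transform_growth _ r' (Num.min 1 d)).
- by apply: lt_trans (lt_trans hb br'); rewrite addr_gt0.
- by rewrite lt_min ltr01.
- move=> z [[zr /notin_closure_strip zb]|[Kz zr]]; split => // zeta Tz; rewrite ge_min.
    by apply/orP; left; apply: strip_dist Tz _; apply: le_trans zb; exact: ltW.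
  by apply/orP; right; apply: Hd Tz; exact: interior_subset Kz.
Qed.

End cauchy_transform.

(** * Splitting a functional *)

Section splitting.
Context {R : realType}.
Variable w : R -> R.
Hypotheses (weight_w : weight_function w) (delta_w : cond_delta w).

(** Hahn-Banach on the space of all functions; those without a finite weighted supremum are related
    to no number by [N], so they impose no constraint. *)
Lemma dual_extension (f : dual w) : exists h l C (L : (cplx R -> cplx R) -> cplx R),
  [/\ [/\ 0 < h, 0 < l & 0 <= C],
   forall u v (k : cplx R), L (fun z => u z + k * v z) = L u + k * L v,
   forall v M, wbounded w h l v M -> nc (L v) <= C * M &
   forall phi : testfun w, L phi = f phi].
Proof.
have [h [l [C [h0 l0 C0 fC]]]] := dual_bounded weight_w f.
have /asboolP[lf _] := dualP f.
(* Hahn-Banach is stated for a total function with hypotheses on a subspace only; 0 is a default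
   value outside the test functions. *)
pose f0 (v : cplx R -> cplx R) : R[i] :=
  if pselect (v \in test_pred w) is left p then f (Testfun p) else 0.
have f0E (phi : testfun w) : f0 phi = f phi.
  rewrite /f0; case: pselect => [p|]; last by have := testfunP phi.
  by congr (dual_val f _); exact: val_inj.
pose N (v : cplx R -> cplx R) a := exists2 M, wbounded w h l v M & a = C * M.
have [|||||||L [Llin LE Lb]] := @hahn_banach R (cplx R -> cplx R) N _ _ _
  [set v | v \in test_pred w] f0.
- by exists 0; rewrite ?mulr0// => z _; rewrite (Normc.normc0 R) mul0r.
- move=> u v a b [M HM ->] [M' HM' ->]; exists (M + M'); last by rewrite mulrDr.
  move=> z zh; apply: le_trans (lerD (HM z zh) (HM' z zh)).
  by rewrite -mulrDl ler_wpM2r ?expR_ge0// le_normcD.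
- move=> k u a [M HM ->]; exists (nc k * M); last by rewrite mulrCA.
  move=> z zh; have := ler_wpM2l (normc_ge0 k) (HM z zh).
  by rewrite mulrA -Normc.normcM.
- exact: (testfunP (0 : testfun w)).
- move=> u v k /= Hu Hv.
  exact: (testfunP (Testfun Hu + k *: Testfun Hv)).
- move=> u v k /= Hu Hv.
  have -> : f0 (u + k *: v) = f (k *: Testfun Hv + Testfun Hu).
    by rewrite -f0E addrC.
  rewrite (lf k (Testfun Hv) (Testfun Hu)) addrC.
  by rewrite -(f0E (Testfun Hu)) -(f0E (Testfun Hv)).
- move=> u a /= Hu [M HM ->]; rewrite -[u]/(testfun_val (Testfun Hu)) f0E.
  exact: fC.
exists h, l, (2 * C), L; split => //.
- by split => //; rewrite mulr_ge0.
- by move=> v M HM; rewrite -mulrA; apply: Lb; exists M.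
- by move=> phi; rewrite LE ?f0E//; exact: (testfunP phi).
Qed.

Lemma real_supp_sub (f : dual w) (Om K : set (\bar R)) : open Om -> vanishes_on Om f ->
  ~` K `<=` Om -> real_supp f `<=` K.
Proof.
move=> oOm vOm KOm x /= xf; apply: contrapT => nK; apply: xf.
by exists Om => //; exact: KOm.
Qed.

Lemma closed_real_gap (K : set (\bar R)) (a : R) : closed K -> ~ K a%:E ->
  exists2 d, 0 < d & forall x : R, K x%:E -> d <= `|x - a|.
Proof.
move=> cK nKa; have : nbhs a%:E (~` K).
  by apply: open_nbhs_nbhs; split => //; exact: closed_openC.
rewrite [nbhs a%:E _]/(nbhs a (fun x => ~ K x%:E)).
move=> /nbhs_ballP[d /= d0 Hd]; exists d => // x Kx.
rewrite leNgt; apply/negP => xd; apply: (Hd x) Kx.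
by rewrite /ball /= distrC.
Qed.

(** By the last hypothesis no point of the cut set is nearer to [x] than [a] is. A closed [K] inside
    [Om] misses [a], hence stays at positive distance from [a] and so from the cut set. The factor
    [s] adjusts the sign of the piece. *)
Lemma dual_cut h l C (L : (cplx R -> cplx R) -> cplx R)
    (q : R -> bool) (s : cplx R) (a y0 : R) (Om : set (\bar R)) :
  0 < h -> 0 < l -> 0 <= C -> nc s <= 1 -> q y0 ->
  (forall u v (k : cplx R), L (fun z => u z + k * v z) = L u + k * L v) ->
  (forall v M, wbounded w h l v M -> nc (L v) <= C * M) ->
  ~ Om a%:E ->
  (forall x y, Om x%:E -> q y -> `|x - a| <= `|y - x|) ->
  exists2 g : dual w, vanishes_on Om g &
    forall phi : testfun w, g phi = L (fun z => if q (Re z) then s * phi z else 0).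
Proof.
move=> h0 l0 C0 s1 qy0 Llin Lb nOm sep.
pose Lq (v : cplx R -> cplx R) := L (fun z => if q (Re z) then s * v z else 0).
pose T := [set z : cplx R | strip h z /\ q (Re z)].
have Lqlin u v (k : cplx R) : Lq (fun z => u z + k * v z) = Lq u + k * Lq v.
  rewrite /Lq -Llin; congr L; apply/funext => z.
  by case: ifP => _; [ring|rewrite mulr0 addr0].
have Lqb v M : (forall z, T z -> nc (v z) * expR (wext w (l * Re z)) <= M) ->
    nc (Lq v) <= C * M.
  move=> HM; apply: Lb => z zh; case: ifPn => [qz|_].
    apply: le_trans (HM z _); last by split.
    by rewrite Normc.normcM ler_wpM2r ?expR_ge0// ler_piMl ?normc_ge0.
  (* Where the cut function is 0, the bound amounts to [0 <= M]; this is read off at a point of [T],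
     provided by [y0]. *)
  rewrite (Normc.normc0 R) mul0r; apply: le_trans (HM (y0 +i* 0) _).
    by rewrite mulr_ge0 ?normc_ge0 ?expR_ge0.
  by split => //; rewrite /strip /= normr0.
have Tb (v : testfun w) M : wbounded w h l v M -> nc (Lq v) <= C * M.
  by move=> HM; apply: Lqb => z [zh _]; exact: HM.
have Lqdual : (fun phi : testfun w => Lq phi) \in @dual_pred R w.
  apply: (bounded_dual h0 l0 C0 _ Tb) => k u v.
  rewrite [LHS](_ : _ = Lq (fun z => v z + k * u z)); first by rewrite Lqlin addrC.
  by congr Lq; apply/funext => z; exact: addrC.
exists (Dual Lqdual) => //.
have [P P1] := cutoff_kernel_test weight_w.
have dist (z zeta : cplx R) d : d <= `|Re z - a| -> Om (Re z)%:E -> T zeta -> d <= nc (zeta - z).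
  move=> dz Oz [_ qzeta]; apply: le_trans dz _; apply: le_trans (sep _ _ Oz qzeta) _.
  by apply: le_trans (normr_Re _); rewrite RecD RecN.
apply: (cauchy_transform_vanishes weight_w delta_w h0 l0 C0 _ Lqlin Lqb P1) => //.
- by move=> z [].
- move=> x Ox; have xa : x != a by apply: contra_notN nOm => /eqP <-.
  exists `|x - a|; first by rewrite normr_gt0 subr_eq0.
  by move=> z zeta zx; apply: dist; rewrite zx.
- move=> K cK KOm; have [d d0 Hd] := closed_real_gap cK (fun Ka => nOm (KOm _ Ka)).
  by exists d => // z zeta Kz; apply: dist; [exact: Hd|exact: KOm].
Qed.

(** [f1] is the piece over [a <= Re zeta] and [f2] is minus the piece over [Re zeta < a], so that
    the difference restores [f]. *)
Lemma dual_split (f : dual w) (a : R) : exists f1 f2 : dual w,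
  [/\ f1 - f2 = f, vanishes_on [set x | (x < a%:E)%E] f1 &
      vanishes_on [set x | (a%:E < x)%E] f2].
Proof.
have [h [l [C [L [[h0 l0 C0] Llin Lb Lf]]]]] := dual_extension f.
have n1 : nc (1 : cplx R) <= 1 by rewrite (Normc.normc1 R).
have nN1 : nc (-1 : cplx R) <= 1 by rewrite normcN (Normc.normc1 R).
have [||f1 v1 E1] := @dual_cut h l C L (fun x => a <= x) 1 a a
  [set x | (x < a%:E)%E] h0 l0 C0 n1 (lexx a) Llin Lb.
- by rewrite /= ltxx.
- move=> x y /=; rewrite lte_fin => xa ay; rewrite ltr0_norm ?gtr0_norm; lra.
have a1 : a - 1 < a by lra.
have [||f2 v2 E2] := @dual_cut h l C L (fun x => x < a) (-1) a (a - 1)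
  [set x | (a%:E < x)%E] h0 l0 C0 nN1 a1 Llin Lb.
- by rewrite /= ltxx.
- move=> x y /=; rewrite lte_fin => ax ya; rewrite gtr0_norm ?ltr0_norm; lra.
exists f1, f2; split => //; apply/val_inj/funext => phi /=.
transitivity (f1 phi - f2 phi) => //.
rewrite E1 E2 -Lf -(functionalB Llin); congr L; apply/funext => z.
by have [_|_] := leP a (Re z); rewrite ?subr0 ?sub0r ?mul1r // mulN1r opprK.
Qed.

End splitting.

(** * Exactness of the sequence *)

Theorem theorem6p1 (R : realType) (a b : R) (w : R -> R)
    (le_ab : a <= b) (weight_w : weight_function w)
    (delta_w : cond_delta w) (epsilon0_w : cond_epsilon0 w) :
  let diag := fun f : dual w => (f, f) in
  let lambda := fun f : dual w * dual w => f.1 - f.2 in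
  let A : set (dual w) :=
    dual_supported [set x | (a%:E <= x)%E /\ (x <= b%:E)%E] in
  let B : set (dual w * dual w) := dual_plus a `*` dual_minus b in
  [/\ set_inj A diag,
      diag @` A = B `&` [set f | lambda f = 0] &
      lambda @` B = [set: dual w]].
Proof.
move=> diag lambda A B; split.
- by move=> f g _ _ [].
(* Once [f1 = f2], the two support conditions concern the same set, and [[a, b]] is the intersection
   of the two half-lines. *)
- apply/seteqP; split=> [_ [f Af <-]|[f1 f2] [[/= f1a f2b] /subr0_eq E]].
    split; last exact: subrr.
    by split=> x /Af[].
  rewrite /= in E; move: f1a; rewrite {}E => f2a; exists f2 => // x xf2.
  by split; [exact: f2a|exact: f2b].
- apply/seteqP; split=> // f _.
  have [f1 [f2 [fE v1 v2]]] := dual_split weight_w delta_w f a.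
  have s1 : real_supp f1 `<=` [set x | (a%:E <= x)%E].
    apply: (real_supp_sub (@open_ereal_lt_ereal _ a%:E) v1) => x /= /negP.
    by rewrite -ltNge.
  (* The cut is made at [a], so [f2] lives on [[-oo, a]], which lies in [[-oo, b]] because
     [a <= b]. *)
  have s2 : real_supp f2 `<=` [set x | (x <= b%:E)%E].
    apply: (real_supp_sub (@open_ereal_gt_ereal _ a%:E) v2) => x /= /negP.
    by rewrite -ltNge; apply: le_lt_trans; rewrite lee_fin.
  by exists (f1, f2).
Qed.
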